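(* Let $\rho_{9,t}=\frac{999815240367}{10^{12}}$ (so $\rho_{9,t}<1$). Every order-nine rank-four tight correlation matrix $C$ satisfies $$\operatorname{per}(C\circ\overline C)\le\rho_{9,t}\,\operatorname{per}(C)^2 .$$ The same inequality $\operatorname{per}(A\circ\overline A)\le\rho_{9,t}\operatorname{per}(A)^2$ holds for every $9\times 9$ complex Hermitian positive semidefinite matrix $A$ with positive diagonal entries whose correlation normalization is a rank-four tight correlation matrix. Furthermore, if $A,B$ are $9\times 9$ complex Hermitian positive semidefinite matrices with positive diagonal entries such that both correlation normalizations are rank-four tight correlation matrices, then $$\operatorname{per}(A\circ B)\le\rho_{9,t}\,\operatorname{per}(A)\operatorname{per}(B).$$
   Context: For an $n\times n$ complex matrix $A=(a_{ij})$, $\operatorname{per}A=\sum_{\sigma\in S_n}\prod_{i=1}^n a_{i,\sigma(i)}$. $A\circ B$ is the entrywise product and $\overline A$ the entrywise complex conjugate. A correlation matrix is a complex Hermitian positive semidefinite matrix all of whose diagonal entries equal one. An order-nine correlation matrix $C$ (i.e. of size $9\times 9$) is called rank-four tight if it has exactly four nonzero eigenvalues (counted with multiplicity), each equal to $9/4$; equivalently, there are unit row vectors $v_1,\dots,v_9\in\mathbb C^4$ with $C_{ij}=v_i\overline{v_j}^{\,T}$ and $\sum_{i=1}^9 v_i^*v_i=\frac94 I_4$, where ${}^*$ is the conjugate transpose. The correlation normalization of a Hermitian positive semidefinite matrix $A=(a_{ij})$ with positive diagonal is $D^{-1}AD^{-1}$, where $D=\operatorname{diag}(\sqrt{a_{11}},\dots,\sqrt{a_{nn}})$.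 *)

(* Defs.v *)
From mathcomp Require Import all_boot all_order all_fingroup all_algebra.

Set Implicit Arguments.
Unset Strict Implicit.
Unset Printing Implicit Defensive.

Import GRing.Theory Num.Theory.
Local Open Scope ring_scope.

Definition per (R : pzSemiRingType) (n : nat) (A : 'M[R]_n) : R :=
  \sum_(s : 'S_n) \prod_(i < n) A i (s i).

Definition hadamard (R : pzSemiRingType) (m n : nat) (A B : 'M[R]_(m, n)) :
  'M[R]_(m, n) := map2_mx *%R A B.

Section CorrelationMatrices.

Variable C : numClosedFieldType.

(* In a numClosedFieldType, 0 <= z entails that z is real. *)
Definition psdmx (n : nat) (A : 'M[C]_n) : Prop :=
  A \is hermsymmx /\
  forall u : 'rV[C]_n, 0 <= (u *m A *m (map_mx Num.conj u)^T) 0 0.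

Definition posdiag (n : nat) (A : 'M[C]_n) : Prop := forall i, 0 < A i i.

Definition correlationmx (n : nat) (A : 'M[C]_n) : Prop :=
  psdmx A /\ forall i, A i i = 1.

(* All nonzero eigenvalues equal 9/4, and their number, counted with
   multiplicity in the characteristic polynomial, is four. *)
Definition rank4_tight (A : 'M[C]_9) : Prop :=
  [/\ correlationmx A,
      forall a, eigenvalue A a -> a != 0 -> a = 9 / 4
    & mup (9 / 4) (char_poly A) = 4%N].

Definition corr_normalization (n : nat) (A : 'M[C]_n) : 'M[C]_n :=
  let D := diag_mx (\row_i sqrtC (A i i)) in invmx D *m A *m invmx D.

End CorrelationMatrices.

(* 999815240367 / 10^12, with the numerator split into groups of three digits:
   numerals denote images of unary naturals. *)
Definition rho9t (F : numFieldType) : F :=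
  (999 * 10 ^+ 9 + 815 * 10 ^+ 6 + 240 * 10 ^+ 3 + 367) / 10 ^+ 12.

(* Main.v *)
From HB Require Import structures.
Require Import Defs.
From mathcomp Require Import all_boot all_order all_fingroup all_algebra.
From mathcomp Require Import complex reals.
From mathcomp Require Import mpoly ring lra zify.

(** The permanent of a Gram matrix is a squared norm. Give polynomials the inner
product for which the monomials are orthogonal and 'X_[m] has squared norm the
product of the factorials of its exponents. Multiplication by the linear form
l_v of a vector v is then adjoint to the derivative along v, and the product of
the forms of v_1, ..., v_N has squared norm the permanent of the matrix of the
inner products <v_i, v_j> ([fock_prod_per]).

Let v_1, ..., v_9 have the tight matrix C as Gram matrix. For a set A of indices
let l_A be the product of the forms l_i with i in A, and let Q_d be the sum of
||l_A||^2 over the sets of size d: thus Q_0 = 1, Q_1 = 9 and Q_9 = per C. Tightness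
is the equation C^2 = (9/4) C. It makes the sum over i of l_i times the derivative
along v_i act on every l_j as multiplication by 9/4, so that for a product f of d
of the forms the sum over i of ||l_i f||^2 is (9 + 9d/4) ||f||^2. Take f = l_A and
sum over A: the indices i outside A give (d+1) Q_(d+1), those in A give the sum
X_(d-1) of ||l_i^2 l_A'||^2 over the sets A' of size d - 1 and the i outside A'
([level_tight]).

What is needed is thus control of X_d by Q_d and Q_(d+1). Expand l_A in powers of
l_i. The terms of different degrees m in l_i are orthogonal, and if P_m is the
squared norm of the term of degree m, then ||l_i^a l_A||^2 is the sum of the
(m+a)!/m! P_m ([number_distribution]). So ||l_A||^2, ||l_i l_A||^2 and
||l_i^2 l_A||^2 are moments of one measure on the integers 0, ..., d, and every
polynomial inequality on these integers is a linear inequality between them.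
From m (m-1) >= 0 and (m-1) (m-2) >= 0 come lower bounds on X_d, that is, upper
bounds on the Q_d. From m (m-1) <= (d-2) m + d [m = d] come lower bounds on the
Q_d: the mass at m = d is explicit, d! times the product of the |C_ij|^2 for j in A,
and Maclaurin's inequality bounds its total by a multiple of E, the sum over i of the
|C_ij|^2 |C_ik|^2 over the pairs {j, k} avoiding i. One more use of tightness, on the
products l_j^2 l_A, sharpens the bound on Q_5. The result is
per C >= 69/10 - E/12 ([tight_level9_ge]).

The matrix of the |C_ij|^2 is the Gram matrix of the tensors of v_i with its
conjugate. Its entries are nonnegative and its rows have sum 9/4, hence its
spectrum lies below 9/4 and the relation between the Q_d and X_d survives as an
inequality, which is enough for upper bounds: its permanent is at most
244/5 - 107/50 E ([bessel_level9_le]). Since 45/32 <= E <= 225/32, the permanent of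
the squared moduli is at most 999/1000 (per C)^2 ([ratio_bound]), and 999/1000 is
below rho.

Rescaling rows and columns multiplies both sides of the inequality by the same
factor, and the Hadamard product of two matrices follows from the case of a matrix
and its conjugate by the Cauchy-Schwarz inequality over permutations. *)

Set Implicit Arguments.
Unset Strict Implicit.
Unset Printing Implicit Defensive.

Import Order.TTheory GRing.Theory Num.Theory.
Local Open Scope ring_scope.

(** * The Fock inner product on polynomials *)

Section Fock.

Variables (C : numClosedFieldType) (n : nat).
Implicit Types (f g h : {mpoly C[n]}) (u v w : 'rV[C]_n).

Definition mnm_fact (m : 'X_{1..n}) : C := \prod_(k < n) (m k)`!%:R.

(** The sum runs over the support of the second argument only, which makes
linearity in the first one immediate; [fockC] then gives the other. *)
Definition fock f g : C :=
  \sum_(m <- msupp g) mnm_fact m * f@_m * (g@_m)^*.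

Definition hdot u v : C := \sum_k u 0 k * (v 0 k)^*.

Definition linform v : {mpoly C[n]} := \sum_k v 0 k *: 'X_k.

(** The conjugate makes this the adjoint of the multiplication by [linform v]. *)
Definition pderiv v f : {mpoly C[n]} := \sum_k (v 0 k)^* *: f^`M(k).

Lemma mnm_fact_gt0 m : 0 < mnm_fact m.
Proof. by apply: prodr_gt0 => k _; rewrite ltr0n fact_gt0. Qed.

Lemma fockZl a f g : fock (a *: f) g = a * fock f g.
Proof. by rewrite /fock mulr_sumr; apply: eq_bigr => m _; rewrite mcoeffZ; ring. Qed.

Lemma fockDl f f' g : fock (f + f') g = fock f g + fock f' g.
Proof. by rewrite /fock -big_split; apply: eq_bigr => m _ /=; rewrite mcoeffD; ring. Qed.

Lemma fock0l g : fock 0 g = 0.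
Proof. by rewrite -(scale0r 0) fockZl mul0r. Qed.

Lemma fock_suml I (r : seq I) (P : pred I) (F : I -> {mpoly C[n]}) g :
  fock (\sum_(i <- r | P i) F i) g = \sum_(i <- r | P i) fock (F i) g.
Proof. by apply: (big_morph (fock^~ g)) => [f f'|]; rewrite ?fockDl ?fock0l. Qed.

Lemma fockX m g : fock 'X_[m] g = mnm_fact m * (g@_m)^*.
Proof.
rewrite /fock; case: (boolP (m \in msupp g)) => [mg|mg].
  rewrite (bigD1_seq m) ?msupp_uniq //= mcoeffX eqxx mulr1 big1 ?addr0 //.
  by move=> m' /negPf nm; rewrite mcoeffX eq_sym nm mulr0 mul0r.
rewrite big1_seq => [|m' /= m'g]; first by rewrite (memN_msupp_eq0 mg) rmorph0 mulr0.
by rewrite mcoeffX; case: eqP m'g mg => [->->|]; rewrite // mulr0 mul0r.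
Qed.

Lemma fock11 : fock 1 1 = 1.
Proof.
rewrite -mpolyX0 fockX mcoeffX eqxx rmorph1 mulr1 /mnm_fact.
by rewrite big1 // => k _; rewrite mnm0E.
Qed.

Lemma fockC f g : fock g f = (fock f g)^*.
Proof.
rewrite {2}[f]mpolyE fock_suml rmorph_sum; apply: eq_bigr => m _.
rewrite fockZl fockX !rmorphM /= conjCK.
have /CrealP -> : mnm_fact m \is Num.real by rewrite gtr0_real ?mnm_fact_gt0.
by ring.
Qed.

Lemma fockZr a f g : fock f (a *: g) = a^* * fock f g.
Proof. by rewrite fockC fockZl rmorphM /= -fockC. Qed.

Lemma fockDr f g g' : fock f (g + g') = fock f g + fock f g'.
Proof. by rewrite fockC fockDl rmorphD /= [fock f g]fockC [fock f g']fockC. Qed.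

Lemma fock_sumr I (r : seq I) (P : pred I) (F : I -> {mpoly C[n]}) f :
  fock f (\sum_(i <- r | P i) F i) = \sum_(i <- r | P i) fock f (F i).
Proof. by rewrite fockC fock_suml rmorph_sum; apply: eq_bigr => i _; rewrite [RHS]fockC. Qed.

Lemma fock0r f : fock f 0 = 0.
Proof. by rewrite fockC fock0l rmorph0. Qed.

Lemma fock_ge0 f : 0 <= fock f f.
Proof.
by apply: sumr_ge0 => m _; rewrite -mulrA mulr_ge0 ?mul_conjC_ge0 // ltW ?mnm_fact_gt0.
Qed.

Lemma mnm_factU m k : mnm_fact (m + U_(k)%MM) = (m k).+1%:R * mnm_fact m.
Proof.
rewrite /mnm_fact (bigD1 k) //= [in RHS](bigD1 k) //= !mnmDE mnm1E eqxx addn1 factS natrM.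
rewrite mulrA; congr (_ * _ * _); apply: eq_bigr => j /negPf nj.
by rewrite mnmDE mnm1E eq_sym nj addn0.
Qed.

(** Raising the exponent of 'X_k multiplies the factorial by the new exponent,
which is also the coefficient that differentiation brings down. *)
Lemma fock_mulX k f g : fock ('X_k * f) g = fock f g^`M(k).
Proof.
rewrite [f]mpolyE mulr_sumr !fock_suml; apply: eq_bigr => m _.
rewrite -scalerAr !fockZl -mpolyXD !fockX addmC mnm_factU mcoeff_deriv.
by rewrite rmorphMn /= -mulr_natl; ring.
Qed.

Lemma fock_linform v f g : fock (linform v * f) g = fock f (pderiv v g).
Proof.
rewrite /linform mulr_suml fock_suml /pderiv fock_sumr; apply: eq_bigr => k _.
by rewrite -scalerAl fockZl fockZr fock_mulX conjCK.
Qed.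

Lemma pderiv_is_linear v : linear (pderiv v).
Proof.
move=> a f g; rewrite /pderiv scaler_sumr -big_split /=; apply: eq_bigr => k _.
by rewrite mderivD mderivZ scalerDr !scalerA mulrC.
Qed.

HB.instance Definition _ v :=
  GRing.isLinear.Build C {mpoly C[n]} {mpoly C[n]} _ (pderiv v) (pderiv_is_linear v).

Lemma pderivM v f g : pderiv v (f * g) = pderiv v f * g + f * pderiv v g.
Proof.
rewrite /pderiv mulr_suml mulr_sumr -big_split /=; apply: eq_bigr => k _.
by rewrite mderivM scalerDr -scalerAl -scalerAr.
Qed.

Lemma pderivC v c : pderiv v c%:MP = 0.
Proof. by rewrite /pderiv big1 // => k _; rewrite mderivC scaler0. Qed.

Lemma mderiv_linform v k : (linform v)^`M(k) = (v 0 k)%:MP.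
Proof.
rewrite /linform (linear_sum (mderiv k)) (bigD1 k) //= big1 ?addr0 => [|j /negPf nj].
  have U0 : (U_(k) - U_(k) = 0 :> 'X_{1..n})%MM.
    by apply/mnmP => j; rewrite mnmBE subnn mnm0E.
  by rewrite mderivZ mderivX mnm1E eqxx scale1r U0 mpolyX0 -mul_mpolyC mulr1.
by rewrite mderivZ mderivX mnm1E nj scale0r scaler0.
Qed.

Lemma pderiv_linform v u : pderiv v (linform u) = (hdot u v)%:MP.
Proof.
rewrite /pderiv /hdot rmorph_sum; apply: eq_bigr => k _ /=.
by rewrite mderiv_linform -mul_mpolyC -mpolyCM mulrC.
Qed.

Lemma linform_is_linear : linear linform.
Proof.
move=> a u v; rewrite /linform scaler_sumr -big_split /=; apply: eq_bigr => k _.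
by rewrite !mxE scalerDl scalerA.
Qed.

HB.instance Definition _ :=
  GRing.isLinear.Build C 'rV[C]_n {mpoly C[n]} _ linform linform_is_linear.

Lemma hdotC u v : hdot v u = (hdot u v)^*.
Proof.
by rewrite /hdot rmorph_sum; apply: eq_bigr => k _; rewrite rmorphM /= conjCK mulrC.
Qed.

Lemma hdotBl u v w : hdot (u - v) w = hdot u w - hdot v w.
Proof.
by rewrite /hdot -sumrB; apply: eq_bigr => k _; rewrite !mxE mulrBl.
Qed.

Lemma hdotZl a u w : hdot (a *: u) w = a * hdot u w.
Proof.
by rewrite /hdot mulr_sumr; apply: eq_bigr => k _; rewrite !mxE mulrA.
Qed.

End Fock.

(** * Expansion in powers of one linear form *)

Section Decomposition.

Variables (R : rcfType) (n : nat).
Local Notation C := R[i].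
Implicit Types (f g h : {mpoly C[n]}) (u v w : 'rV[C]_n).

(** Squared norms are taken in the real field, where linear arithmetic is available. *)
Definition sqnorm f : R := complex.Re (fock f f).

Lemma fockE f : fock f f = (sqnorm f)%:C%C.
Proof.
rewrite /sqnorm; have := fock_ge0 f; case: (fock f f) => a b /=.
by rewrite lecE /= => /andP[/eqP -> _].
Qed.

Lemma sqnorm_ge0 f : 0 <= sqnorm f.
Proof. by have := fock_ge0 f; rewrite fockE lecR. Qed.

Lemma sqnorm1 : sqnorm 1 = 1.
Proof. by rewrite /sqnorm fock11. Qed.

Definition linprod (us : seq 'rV[C]_n) : {mpoly C[n]} := \prod_(u <- us) linform u.

Lemma fock_linformr v f g : fock f (linform v * g) = fock (pderiv v f) g.
Proof. by rewrite fockC fock_linform -fockC. Qed.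

Lemma pderiv_expM v m h : hdot v v = 1 -> pderiv v h = 0 ->
  pderiv v (linform v ^+ m * h) = m%:R *: (linform v ^+ m.-1 * h).
Proof.
move=> v1 dh; rewrite pderivM dh mulr0 addr0.
elim: m => [|m IH]; first by rewrite expr0 -mpolyC1 pderivC mul0r scale0r.
rewrite exprS pderivM pderiv_linform v1 mpolyC1 mul1r mulrDl -mulrA IH -scalerAr.
case: m {IH} => [|m] /=; first by rewrite mulr0n scale0r addr0 mulr1n scale1r.
by rewrite mulrA -exprS -[X in X + _]scale1r -scalerDl nat1r.
Qed.

(** Each derivative along v removes one factor [linform v]; when the two powers
differ, a derivative is left over and falls on g or h. *)
Lemma fock_expM v m k g h : hdot v v = 1 -> pderiv v g = 0 -> pderiv v h = 0 ->
  fock (linform v ^+ m * g) (linform v ^+ k * h) = (m`!%:R *+ (m == k)) * fock g h.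
Proof.
move=> v1 dg dh; elim: m k => [|m IH] [|k].
- by rewrite !expr0 !mul1r.
- by rewrite expr0 mul1r exprS -mulrA fock_linformr dg fock0l mul0r.
- by rewrite expr0 mul1r exprS -mulrA fock_linform dh fock0r mul0r.
rewrite exprS -mulrA fock_linform pderiv_expM // fockZr IH /= rmorph_nat eqSS.
by case: eqP => [->|_]; rewrite ?mul0r ?mulr0 // mulrA -natrM factS.
Qed.

(** Split each u into its component along v and a part orthogonal to v, and expand
the product in powers of [linform v]: the coefficients are made of the forms of the
orthogonal parts, so the derivative along v kills them. *)
Lemma linprod_decomp v (us : seq 'rV[C]_n) : hdot v v = 1 ->
  exists p : {poly {mpoly C[n]}},
  [/\ (size p <= (size us).+1)%N, forall m, pderiv v p`_m = 0,
      p`_(size us) = (\prod_(u <- us) hdot u v)%:MP & linprod us = p.[linform v]].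
Proof.
move=> v1; rewrite /linprod; elim: us => [|u us [p [sz dp lp pE]]].
  exists 1; split; first by rewrite size_poly1.
  - by move=> m; rewrite coef1; case: eqP => _; rewrite -?mpolyC1 ?pderivC // raddf0.
  - by rewrite coef1 !big_nil mpolyC1.
  - by rewrite big_nil hornerE.
set c := hdot u v; set w := u - c *: v.
have uE : linform u = c *: linform v + linform w by rewrite -linearZ -linearD addrC subrK.
have dw : pderiv v (linform w) = 0.
  by rewrite pderiv_linform hdotBl hdotZl v1 mulr1 subrr mpolyC0.
exists ((c%:MP)%:P * ('X * p) + (linform w)%:P * p); split.
- have sp : (size ('X * p)%R <= (size us).+2)%N.
    by rewrite mulrC (leq_trans (size_polyMleq _ _)) // size_polyX addn2.
  apply: leq_trans (size_polyD _ _) _; rewrite geq_max !mul_polyC.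
  rewrite (leq_trans (size_scale_leq _ _)) //=.
  by rewrite (leq_trans (size_scale_leq _ _)) //= (leq_trans sz).
- move=> m; rewrite coefD !coefCM coefXM raddfD /= !pderivM dw dp pderivC.
  case: m => [|m] /=; first by rewrite raddf0 !(mul0r, mulr0, addr0).
  by rewrite dp !(mul0r, mulr0, addr0).
- rewrite coefD !coefCM coefXM /= lp big_cons mpolyCM.
  by rewrite [p`__]nth_default ?mulr0 ?addr0.
- by rewrite big_cons pE uE !hornerE mulrDl -mul_mpolyC.
Qed.

(** P m is the squared norm of the term of degree m in [linform v]. The squared
norms on the last line are the rising moments of one measure on the integers
0, ..., size us, so polynomial inequalities on these integers compare them. *)
Lemma number_distribution v (us : seq 'rV[C]_n) : hdot v v = 1 ->
  exists P : nat -> R,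
  [/\ forall m, 0 <= P m,
      (P (size us))%:C%C = (size us)`!%:R * \prod_(u <- us) `|hdot u v| ^+ 2
    & forall a, sqnorm (linform v ^+ a * linprod us)
                = \sum_(m < (size us).+1) ((m + a) ^_ a)%:R * P m].
Proof.
move=> v1; have [p [sz dp lp pE]] := linprod_decomp us v1.
exists (fun m => m`!%:R * sqnorm p`_m); split.
- by move=> m; rewrite mulr_ge0 ?ler0n ?sqnorm_ge0.
- rewrite rmorphM rmorph_nat /= -fockE lp -[_%:MP]mulr1 mul_mpolyC fockZl fockZr.
  rewrite fock11 mulr1 rmorph_prod /= -big_split /=; congr (_ * _).
  by apply: eq_bigr => u _; rewrite normCK.
move=> a; apply: (@complexI R); rewrite -fockE pE rmorph_sum /=.
rewrite (horner_coef_wide _ sz) mulr_sumr fock_suml; apply: eq_bigr => m _.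
rewrite fock_sumr (bigD1 m) //= big1 ?addr0 => [|k /negPf km]; last first.
  rewrite ![p`__ * _]mulrC !mulrA -!exprD fock_expM //.
  by rewrite eqn_add2l [(m : nat) == k]eq_sym [(k : nat) == m]km mul0r.
rewrite [p`__ * _]mulrC !mulrA -!exprD fock_expM // eqxx mulr1n fockE.
rewrite -(rmorph_nat (real_complex R)) -rmorphM /= -natrM.
congr ((_%:R * _)%:C%C).
by rewrite addnC -(ffact_fact (leq_addl m a)) addnK.
Qed.

End Decomposition.

(** * Inequalities between the moments of one mode *)

Section NumberInequalities.

Variables (R : rcfType) (n : nat).
Local Notation C := R[i].
Implicit Types (f g h : {mpoly C[n]}) (u v w : 'rV[C]_n).

Lemma natsum_le d (P : nat -> R) (a b : nat -> nat) :
    (forall m, 0 <= P m) -> (forall m, (m <= d)%N -> (a m <= b m)%N) ->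
  \sum_(m < d.+1) (a m)%:R * P m <= \sum_(m < d.+1) (b m)%:R * P m.
Proof.
move=> P0 ab; apply: ler_sum => m _.
by rewrite ler_wpM2r ?ler_nat ?ab // -ltnS.
Qed.

Lemma number_moments v (us : seq 'rV[C]_n) : hdot v v = 1 ->
  exists P : nat -> R,
  [/\ forall m, 0 <= P m,
      (P (size us))%:C%C = (size us)`!%:R * \prod_(u <- us) `|hdot u v| ^+ 2,
      sqnorm (linprod us) = \sum_(m < (size us).+1) P m,
      sqnorm (linform v * linprod us) - sqnorm (linprod us)
        = \sum_(m < (size us).+1) m%:R * P m
    & sqnorm (linform v ^+ 2 * linprod us)
        = \sum_(m < (size us).+1) (m.+1 * m.+2)%:R * P m /\
      sqnorm (linform v ^+ 3 * linprod us)
        = \sum_(m < (size us).+1) (m.+1 * m.+2 * m.+3)%:R * P m].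
Proof.
move=> /number_distribution-/(_ us)[P [P0 Ptop N]]; exists P.
have N0 : sqnorm (linprod us) = \sum_(m < (size us).+1) P m.
  rewrite -[linprod us]mul1r -(expr0 (linform v)) N.
  by apply: eq_bigr => m _; rewrite ffactn0 mul1r.
split=> //; last split.
- rewrite N0 -[linform v]expr1 N -sumrB; apply: eq_bigr => m _.
  by rewrite addn1 ffactn1 -natr1 mulrDl mul1r addrK.
- by rewrite N; apply: eq_bigr => m _; rewrite addn2 !ffactnS ffactn0 muln1 mulnC.
- rewrite N; apply: eq_bigr => m _; rewrite addn3 !ffactnS ffactn0 muln1 /=.
  by congr (_%:R * _); lia.
Qed.

Section OneMode.

Variables (v : 'rV[C]_n) (us : seq 'rV[C]_n).
Hypothesis v1 : hdot v v = 1.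
Local Notation N0 := (sqnorm (linprod us)).
Local Notation N1 := (sqnorm (linform v * linprod us)).
Local Notation N2 := (sqnorm (linform v ^+ 2 * linprod us)).
Local Notation N3 := (sqnorm (linform v ^+ 3 * linprod us)).

(** From m (m - 1) >= 0, since (m + 1) (m + 2) = 4 (m + 1) - 2 + m (m - 1). *)
Lemma sqnorm_sq_ge : 4 * N1 - 2 * N0 <= N2.
Proof.
have [P [P0 _ E0 E1 [E2 _]]] := number_moments us v1.
suff: 4 * (N1 - N0) + 2 * N0 <= N2 by move: N0 N1 N2 => x y z; lra.
rewrite E1 E0 E2 !mulr_sumr -big_split /=.
under eq_bigr => m _ do rewrite mulrA -mulrDl -natrM -natrD.
apply: (@natsum_le _ P (fun m => 4 * m + 2)%N (fun m => m.+1 * m.+2)%N) => // m _.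
by nia.
Qed.

(** From (m - 1) (m - 2) >= 0, which holds because m is an integer. *)
Lemma sqnorm_sq_ge_integral : 6 * (N1 - N0) <= N2.
Proof.
have [P [P0 _ E0 E1 [E2 _]]] := number_moments us v1.
rewrite E1 E2 !mulr_sumr.
under eq_bigr => m _ do rewrite mulrA -natrM.
apply: (@natsum_le _ P (fun m => 6 * m)%N (fun m => m.+1 * m.+2)%N) => //.
by move=> [|[|[|m]]] _ //; nia.
Qed.

(** With one factor, m is 0 or 1 and m (m - 1) vanishes. *)
Lemma sqnorm_sq_le_size1 : size us = 1 -> N2 <= 4 * N1 - 2 * N0.
Proof.
have [P [P0 _ E0 E1 [E2 _]]] := number_moments us v1 => sz.
suff: N2 <= 4 * (N1 - N0) + 2 * N0 by move: N0 N1 N2 => x y z; lra.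
rewrite E1 E0 E2 sz !mulr_sumr -big_split /=.
under [leRHS]eq_bigr => m _ do rewrite mulrA -mulrDl -natrM -natrD.
apply: (@natsum_le _ P (fun m => m.+1 * m.+2)%N (fun m => 4 * m + 2)%N) => //.
by move=> [|[|m]].
Qed.

Variable t : R.
Hypothesis tE : t%:C%C = (size us)`!%:R * \prod_(u <- us) `|hdot u v| ^+ 2.

(** With two factors, m (m - 1) is supported at the top value m = 2. *)
Lemma sqnorm_sq_size2 : size us = 2 -> N2 = 4 * N1 - 2 * N0 + 2 * t.
Proof.
have [P [P0 Pt E0 E1 [E2 _]]] := number_moments us v1 => sz.
have {Pt} Pt : t = P 2 by apply: (@complexI R); rewrite tE -Pt sz.
move: E0 E1 E2; rewrite sz !big_ord_recl !big_ord0 /= -Pt.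
by rewrite /bump /=; move: N0 N1 N2 => x y z E0 E1 E2; lra.
Qed.

Lemma sqnorm_cube_size2 : size us = 2 -> N3 = 18 * N1 - 12 * N0 + 18 * t.
Proof.
have [P [P0 Pt E0 E1 [_ E3]]] := number_moments us v1 => sz.
have {Pt} Pt : t = P 2 by apply: (@complexI R); rewrite tE -Pt sz.
move: E0 E1 E3; rewrite sz !big_ord_recl !big_ord0 /= -Pt.
by rewrite /bump /=; move: N0 N1 N3 => x y z E0 E1 E3; lra.
Qed.

(** From m (m - 1) <= (d - 2) m + d [m = d] for m <= d. Isolating the top mass,
which is explicit, improves the factor d - 1 of the trivial bound to d - 2. *)
Lemma sqnorm_sq_le :
  N2 <= 2 * N0 + (size us).+2%:R * (N1 - N0) + (size us)%:R * t.
Proof.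
have [P [P0 Pt E0 E1 [E2 _]]] := number_moments us v1.
have {Pt} Pt : t = P (size us) by apply: (@complexI R); rewrite tE -Pt.
have -> : (size us)%:R * t = \sum_(m < (size us).+1) (size us * (m == size us :> nat))%:R * P m.
  rewrite big_ord_recr /= big1 ?eqxx ?muln1 ?add0r ?Pt // => m _.
  by rewrite ltn_eqF ?muln0 ?mul0r.
rewrite E1 E0 E2 !mulr_sumr -!big_split /=.
under [leRHS]eq_bigr => m _ do rewrite mulrA -!mulrDl -natrM -!natrD.
apply: (@natsum_le _ P (fun m => m.+1 * m.+2)%N
  (fun m => 2 + (size us).+2 * m + size us * (m == size us))%N) => // m.
case: eqP => [->|/eqP nm] lem; first by nia.
have {nm}lem : (m < size us)%N by rewrite ltn_neqAle nm.
by nia.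
Qed.

End OneMode.

End NumberInequalities.

(** * Sums over a frame *)

Section FrameSums.

Variables (R : rcfType) (n : nat) (I : finType).
Local Notation C := R[i].
Implicit Types (f g h : {mpoly C[n]}).

Lemma fock_linform_sq (v : 'rV[C]_n) f : hdot v v = 1 ->
  fock (linform v * f) (linform v * f) = fock f f + fock f (linform v * pderiv v f).
Proof.
move=> v1; rewrite fock_linform pderivM pderiv_linform v1 mpolyC1 mul1r.
by rewrite fockDr.
Qed.

Lemma sqnorm_linform (v : 'rV[C]_n) f : hdot v v = 1 ->
  sqnorm (linform v * f) = sqnorm f + sqnorm (pderiv v f).
Proof.
move=> v1; apply: (@complexI R); rewrite rmorphD /= -!fockE fock_linform_sq //.
by rewrite fock_linformr.
Qed.

Definition refock f g : R := complex.Re (fock f g).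

Lemma refockC f g : refock f g = refock g f.
Proof. by rewrite /refock fockC; case: (fock g f). Qed.

Lemma sqnormZ (a : R) f : sqnorm (a%:C%C *: f) = a ^+ 2 * sqnorm f.
Proof.
apply: (@complexI R); rewrite -fockE fockZl fockZr fockE conj_Creal ?complex_real //.
by rewrite expr2 -mulrA !rmorphM.
Qed.

Lemma sqnormD f g : sqnorm (f + g) = sqnorm f + 2 * refock f g + sqnorm g.
Proof.
transitivity (refock f f + refock f g + refock g f + refock g g).
  by rewrite /sqnorm fockDl !fockDr /refock !raddfD /= addrA.
by rewrite [refock g f]refockC /sqnorm /refock; ring.
Qed.

Lemma sqnormB f g : sqnorm (f - g) = sqnorm f - 2 * refock f g + sqnorm g.
Proof.
have -> : sqnorm (f - g) = refock f f - refock f g - refock g f + refock g g.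
  rewrite /sqnorm -scaleN1r fockDl !fockDr !fockZl !fockZr /refock.
  rewrite rmorphN1 !mulN1r opprK.
  by rewrite !raddfD /= !raddfN /= addrA.
by rewrite [refock g f]refockC /sqnorm /refock; ring.
Qed.

Lemma refock_le f g : 2 * refock f g <= sqnorm f + sqnorm g.
Proof. by have := sqnorm_ge0 (f - g); rewrite sqnormB; lra. Qed.

Lemma euler_linprod (us : seq 'rV[C]_n) :
  \sum_k 'X_k * (linprod us)^`M(k) = (size us)%:R *: linprod us.
Proof.
rewrite /linprod; elim: us => [|u us IH].
  by rewrite big_nil scale0r big1 // => k _; rewrite -mpolyC1 mderivC mulr0.
rewrite !big_cons /=; under eq_bigr => k _ do rewrite mderivM mulrDr [X in _ + X]mulrCA.
rewrite big_split /= -mulr_sumr IH -natr1 scalerDl scale1r addrC -scalerAr.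
congr (_ + _); under eq_bigr => k _ do rewrite mulrA.
rewrite -mulr_suml; congr (_ * _); rewrite {2}/linform; apply: eq_bigr => k _.
by rewrite -/(linform u) mderiv_linform mulrC mul_mpolyC.
Qed.

Lemma sum_sqnorm_mderiv (us : seq 'rV[C]_n) :
  \sum_k sqnorm (linprod us)^`M(k) = (size us)%:R * sqnorm (linprod us).
Proof.
apply: (@complexI R); rewrite rmorphM rmorph_nat rmorph_sum /= -fockE.
rewrite -fockZl -euler_linprod fock_suml; apply: eq_bigr => k _.
by rewrite -fockE fock_mulX.
Qed.

Variable v : I -> 'rV[C]_n.
Hypothesis v1 : forall i, hdot (v i) (v i) = 1.
Variable lam : R.

(** The operator \sum_i linform (v i) * pderiv (v i) is a derivation, and by
tightness each form [linform (v j)] is an eigenvector for lam; so a product of d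
forms is an eigenvector for lam * d. *)
Lemma sum_sqnorm_tight (s : seq I) :
    (forall j, \sum_i hdot (v j) (v i) *: v i = lam%:C%C *: v j) ->
  \sum_i sqnorm (linform (v i) * linprod (map v s))
    = (#|I|%:R + lam * (size s)%:R) * sqnorm (linprod (map v s)).
Proof.
move=> tight.
have eigen : \sum_i linform (v i) * pderiv (v i) (linprod (map v s))
             = (lam%:C%C * (size s)%:R) *: linprod (map v s).
  rewrite /linprod; elim: s => [|j s IH].
    by rewrite big_nil mulr0 scale0r big1 // => k _; rewrite -mpolyC1 pderivC mulr0.
  rewrite /= !big_cons /=; under eq_bigr => i _ do rewrite pderivM mulrDr [X in _ + X]mulrCA.
  rewrite big_split /= -mulr_sumr IH -natr1 mulrDr mulr1 scalerDl -scalerAr addrC.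
  congr (_ + _); under eq_bigr => i _ do rewrite mulrA.
  rewrite -mulr_suml scalerAl; congr (_ * _).
  rewrite -linearZ -tight linear_sum; apply: eq_bigr => i _.
  by rewrite pderiv_linform mulrC mul_mpolyC [RHS]linearZ.
apply: (@complexI R); rewrite rmorphM rmorphD rmorphM !rmorph_nat rmorph_sum /= -fockE.
rewrite mulrDl; under eq_bigr => i _ do rewrite -fockE fock_linform_sq //.
rewrite big_split /= sumr_const -fock_sumr eigen fockZr mulr_natl; congr (_ + _).
by rewrite conj_Creal ?realM ?complex_real ?realn.
Qed.

(** Schur's test: the Gram matrix has nonnegative entries and row sums lam, so the
frame operator is at most lam times the identity. Euler's identity replaces the
eigenvector equation of [sum_sqnorm_tight]. *)
Lemma sum_sqnorm_bessel (b : I -> I -> R) (us : seq 'rV[C]_n) :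
    0 < lam -> (forall i j, 0 <= b i j) -> (forall i j, b i j = b j i) ->
    (forall i j, hdot (v i) (v j) = (b i j)%:C%C) ->
    (forall i, \sum_j b i j = lam) ->
  \sum_i sqnorm (linform (v i) * linprod us)
    <= (#|I|%:R + lam * (size us)%:R) * sqnorm (linprod us).
Proof.
move=> lam0 b0 bC vb bsum; set f := linprod us.
under eq_bigr => i _ do rewrite sqnorm_linform //.
rewrite big_split /= sumr_const mulrDl mulr_natl lerD2l -mulrA -sum_sqnorm_mderiv -/f.
(* Bessel's inequality for the gradient of f: a is the image of the gradient under
   the frame operator, divided by lam, and the gradient minus a has norm >= 0. *)
pose g i := pderiv (v i) f; pose a k := \sum_i (lam^-1%:C%C * v i 0 k) *: g i.
set G := \sum_i _; set S := \sum_k _.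
have cross : \sum_k refock f^`M(k) (a k) = lam^-1 * G.
  rewrite /refock -raddf_sum /=.
  suff -> : \sum_k fock f^`M(k) (a k) = (lam^-1 * G)%:C%C by [].
  under eq_bigr => k _ do rewrite fock_sumr.
  rewrite exchange_big rmorphM rmorph_sum mulr_sumr /=; apply: eq_bigr => i _.
  rewrite -fockE -/(g i) {3}/g /pderiv fock_suml mulr_sumr; apply: eq_bigr => k _.
  rewrite fockZr fockZl rmorphM /= mulrA.
  by rewrite [(lam^-1%:C)%C^*]conj_Creal ?complex_real.
have quad : \sum_k sqnorm (a k) <= lam^-1 * G.
  have -> : \sum_k sqnorm (a k) = lam^-1 ^+ 2 * \sum_i \sum_j b i j * refock (g i) (g j).
    have ReZ (r : R) (z : C) : complex.Re (r%:C%C * z) = r * complex.Re z.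
      by case: z => x y /=; rewrite mul0r subr0.
    have -> : \sum_k sqnorm (a k) = complex.Re (\sum_k fock (a k) (a k)) by rewrite raddf_sum.
    under [\sum_i \sum_j _]eq_bigr => i _ do
      (under eq_bigr => j _ do rewrite /refock -ReZ; rewrite -raddf_sum).
    rewrite -raddf_sum -ReZ /=; congr complex.Re.
    under eq_bigr => k _ do rewrite fock_suml.
    rewrite exchange_big mulr_sumr /=; apply: eq_bigr => i _.
    under eq_bigr => k _ do rewrite fock_sumr.
    rewrite exchange_big mulr_sumr /=; apply: eq_bigr => j _.
    rewrite -vb /hdot mulr_suml mulr_sumr; apply: eq_bigr => k _.
    rewrite fockZl fockZr rmorphM rmorphXn /= [(lam^-1%:C)%C^*]conj_Creal ?complex_real //.
    by ring.
  rewrite expr2 -mulrA ler_pM2l ?invr_gt0 // ler_pdivrMl // /G.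
  apply: (@le_trans _ _ (\sum_i \sum_j b i j * (sqnorm (g i) / 2 + sqnorm (g j) / 2))).
    apply: ler_sum => i _; apply: ler_sum => j _; rewrite ler_wpM2l //.
    by have := refock_le (g i) (g j); move: (refock _ _) (sqnorm _) (sqnorm _) => x y z; lra.
  under eq_bigr => i _ do (under eq_bigr => j _ do rewrite mulrDr; rewrite big_split).
  rewrite big_split /= [X in _ + X]exchange_big /=.
  rewrite [X in _ + X](eq_bigr (fun i => \sum_j b i j * (sqnorm (g i) / 2))); last first.
    by move=> i _; apply: eq_bigr => j _; rewrite bC.
  under eq_bigr => i _ do rewrite -mulr_suml bsum.
  by rewrite -!mulr_sumr -mulr_suml /g; lra.
have : 0 <= \sum_k sqnorm (f^`M(k) - a k) by apply: sumr_ge0 => k _; apply: sqnorm_ge0.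
under eq_bigr => k _ do rewrite sqnormB.
rewrite big_split sumrB -mulr_sumr cross -/S /= => h.
have {}h : lam^-1 * G <= S by lra.
by rewrite -ler_pdivrMl.
Qed.

End FrameSums.

(** * Double counting and elementary symmetric sums over subsets *)

Section SubsetSums.

Variables (R : realFieldType) (I : finType).
Implicit Types (A B D : {set I}) (F : I -> I -> R).

(** Both sides enumerate a set of size d.+1 together with one of its elements. *)
Lemma exchange_subset D d (g : I -> {set I} -> R) :
  \sum_(A : {set I} | (A \subset D) && (#|A| == d.+1)) \sum_(i in A) g i A
  = \sum_(A : {set I} | (A \subset D) && (#|A| == d)) \sum_(i in D :\: A) g i (i |: A).
Proof.
rewrite !pair_big_dep /=.
rewrite (reindex_onto (fun p => (p.2 |: p.1, p.2)) (fun p => (p.1 :\ p.2, p.2))) /=.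
  apply: eq_bigl => -[A i] /=; rewrite !inE eqxx /= andbT.
  rewrite subUset sub1set -andbA.
  rewrite xpair_eqE eqxx andbT.
  have [iA|iA] := boolP (i \in A).
    rewrite !andbF; apply/negP => /and3P[_ _ /eqP h].
    by move: iA; rewrite -h !inE eqxx.
  rewrite setU1K // eqxx andbT cardsU1 iA add1n eqSS /=.
  by rewrite andbAC; case: (i \in D); rewrite ?andbF ?andbT // andbC.
by move=> [A i] /= /andP[_ iA]; rewrite setD1K.
Qed.

Lemma sum_subset1 D (g : {set I} -> R) :
  \sum_(A : {set I} | (A \subset D) && (#|A| == 1)) g A = \sum_(k in D) g [set k].
Proof.
transitivity (\sum_(A : {set I} | (A \subset D) && (#|A| == 1)) \sum_(k in A) g [set k]).
  by apply: eq_bigr => A /andP[_ /cards1P[i ->]]; rewrite big_set1.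
rewrite (exchange_subset D 0 (fun i _ => g [set i])) (big_pred1 set0) ?setD0 // => A.
by rewrite /= cards_eq0; case: eqP => [->|_]; rewrite ?sub0set ?andbF.
Qed.

Lemma exchange_distinct D F :
  \sum_(i in D) \sum_(j in D :\ i) F i j = \sum_(j in D) \sum_(i in D :\ j) F i j.
Proof.
rewrite (exchange_big_dep (mem D)) /= => [|i j _]; last by rewrite inE => /andP[].
by apply: eq_bigr => j jD; apply: eq_bigl => i; rewrite !inE jD andbT eq_sym andbC.
Qed.

Lemma setDU1 D A i : D :\: (i |: A) = (D :\: A) :\ i.
Proof. by apply/setP => j; rewrite !inE negb_or andbA. Qed.

Section Elementary.

Variables (D : {set I}) (x : I -> R).

Definition elemsym d : R :=
  \sum_(A : {set I} | (A \subset D) && (#|A| == d)) \prod_(j in A) x j.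

Lemma elemsym1 : elemsym 1 = \sum_(j in D) x j.
Proof.
rewrite /elemsym (sum_subset1 D (fun A => \prod_(j in A) x j)).
by apply: eq_bigr => k _; rewrite big_set1.
Qed.

(** The factor of index j coming from [elemsym 1] is either already in the product
over A or enlarges it; each set of size d.+1 arises from d.+1 of its subsets. *)
Lemma elemsym_step d : elemsym 1 * elemsym d
  = \sum_(A : {set I} | (A \subset D) && (#|A| == d)) \prod_(j in A) x j * \sum_(j in A) x j
    + d.+1%:R * elemsym d.+1.
Proof.
rewrite elemsym1 mulrC /elemsym mulr_suml mulr_sumr.
rewrite [X in _ + X](eq_bigr (fun A : {set I} => \sum_(i in A) \prod_(j in A) x j)); last first.
  by move=> A /andP[_ /eqP cA]; rewrite sumr_const cA mulr_natl.
rewrite exchange_subset -big_split /=; apply: eq_bigr => A /andP[AD _].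
rewrite [\sum_(j in D) x j](big_setID A) /= (setIidPr AD) mulrDr; congr (_ + _).
rewrite mulr_sumr; apply: eq_bigr => i; rewrite inE => /andP[iA _].
by rewrite big_setU1 //= mulrC.
Qed.

Hypothesis x0 : forall j, 0 <= x j.

(** Maclaurin's inequality. By [elemsym_step] it compares [elemsym d.+2] with the sum
of the products over A times the x j with j in A. Removing from A one index j, both
become sums over pairs of distinct indices outside a set B of size d, of x j * x k in
the first case and of x j ^+ 2 in the second. *)
Lemma elemsym_maclaurin d :
  d.+2%:R * #|D|%:R * elemsym d.+2 <= (#|D| - d.+1)%:R * elemsym 1 * elemsym d.+1.
Proof.
have e := elemsym_step d.+1.
set Y := \sum_(A | _) _ in e.
have [leD|gtD] := leqP #|D| d.+1.
  have -> : elemsym d.+2 = 0.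
    rewrite /elemsym big1 // => A /andP[/subset_leq_card AD /eqP cA]; lia.
  by rewrite mulr0 (_ : #|D| - d.+1 = 0)%N ?mul0r ?mulr0n //; lia.
suff h : d.+1%:R * (d.+2%:R * elemsym d.+2) <= (#|D| - d.+1)%:R * Y.
  rewrite -[X in _ <= X]mulrA e mulrDr.
  have -> : #|D|%:R = (#|D| - d.+1)%:R + d.+1%:R :> R by rewrite -natrD subnK // ltnW.
  by move: h; set a := _%:R; set b := _%:R; set c := _%:R => h; lra.
pose prd (B : {set I}) := \prod_(j in B) x j.
have -> : d.+1%:R * (d.+2%:R * elemsym d.+2)
    = \sum_(B : {set I} | (B \subset D) && (#|B| == d))
        prd B * \sum_(j in D :\: B) \sum_(k in (D :\: B) :\ j) x j * x k.
  transitivity (\sum_(A : {set I} | (A \subset D) && (#|A| == d.+1))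
                  \sum_(j in A) \sum_(k in D :\: A) prd A * x k).
    rewrite [elemsym d.+2]/elemsym mulr_sumr.
    transitivity (d.+1%:R * \sum_(A : {set I} | (A \subset D) && (#|A| == d.+2))
                              \sum_(i in A) prd A).
      congr (_ * _); apply: eq_bigr => A /andP[_ /eqP cA].
      by rewrite sumr_const cA mulr_natl.
    rewrite exchange_subset mulr_sumr; apply: eq_bigr => A /andP[_ /eqP cA].
    rewrite sumr_const cA mulr_natl; congr (_ *+ _); apply: eq_bigr => i.
    by rewrite inE => /andP[iA _]; rewrite /prd big_setU1 //= mulrC.
  rewrite exchange_subset; apply: eq_bigr => B _; rewrite mulr_sumr.
  apply: eq_bigr => j; rewrite inE => /andP[jB _]; rewrite setDU1 mulr_sumr.
  by apply: eq_bigr => k _; rewrite /prd big_setU1 //= mulrA [x j * _]mulrC.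
have -> : (#|D| - d.+1)%:R * Y
    = \sum_(B : {set I} | (B \subset D) && (#|B| == d))
        prd B * \sum_(j in D :\: B) \sum_(k in (D :\: B) :\ j) x j ^+ 2.
  have -> : Y = \sum_(A : {set I} | (A \subset D) && (#|A| == d.+1))
                  \sum_(j in A) prd A * x j.
    by apply: eq_bigr => A _; rewrite mulr_sumr.
  rewrite exchange_subset mulr_sumr; apply: eq_bigr => B /andP[BD /eqP cB].
  rewrite !mulr_sumr; apply: eq_bigr => j jDB; rewrite sumr_const.
  have -> : #|(D :\: B) :\ j| = (#|D| - d.+1)%N.
    have := cardsD1 j (D :\: B); rewrite jDB cardsD (setIidPr BD) cB; lia.
  move: jDB; rewrite inE => /andP[jB _].
  by rewrite -mulr_natl /prd big_setU1 //=; ring.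
apply: ler_sum => B _; rewrite ler_wpM2l ?prodr_ge0 // /prd.
set E := D :\: B.
have sym : \sum_(j in E) \sum_(k in E :\ j) x j ^+ 2 = \sum_(j in E) \sum_(k in E :\ j) x k ^+ 2.
  exact: exchange_distinct.
suff : 2 * \sum_(j in E) \sum_(k in E :\ j) x j * x k
       <= \sum_(j in E) \sum_(k in E :\ j) x j ^+ 2 + \sum_(j in E) \sum_(k in E :\ j) x k ^+ 2.
  by rewrite -sym; lra.
rewrite -big_split mulr_sumr; apply: ler_sum => j _ /=.
rewrite -big_split mulr_sumr; apply: ler_sum => k _ /=.
by have := sqr_ge0 (x j - x k); rewrite sqrrB; lra.
Qed.

End Elementary.

End SubsetSums.

(** * Level sums and their moments *)

Section Moments.

Variables (R : rcfType) (n : nat) (I : finType) (v : I -> 'rV[R[i]]_n).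
Implicit Types (A B : {set I}).
Hypothesis v1 : forall i, hdot (v i) (v i) = 1.

Lemma exchange_setT d (g : I -> {set I} -> R) :
  \sum_(A : {set I} | #|A| == d.+1) \sum_(i in A) g i A
  = \sum_(A : {set I} | #|A| == d) \sum_(i in ~: A) g i (i |: A).
Proof.
have := exchange_subset setT d g; rewrite (eq_bigl (fun A : {set I} => #|A| == d.+1)).
  move=> ->; apply: eq_big => [A|A _]; first by rewrite subsetT.
  by rewrite setTD.
by move=> A; rewrite subsetT.
Qed.

Definition setprod A : {mpoly R[i][n]} := linprod [seq v i | i <- enum A].

Lemma setprodE A : setprod A = \prod_(i in A) linform (v i).
Proof. by rewrite /setprod /linprod big_map big_enum. Qed.

Lemma size_setprod A : size [seq v i | i <- enum A] = #|A|.
Proof. by rewrite size_map -cardE. Qed.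

Lemma setprodU1 A i : i \notin A -> setprod (i |: A) = linform (v i) * setprod A.
Proof. by move=> iA; rewrite !setprodE big_setU1. Qed.

Lemma sqr_linprod j A :
  linform (v j) ^+ 2 * setprod A = linprod [seq v i | i <- j :: j :: enum A].
Proof. by rewrite /setprod /linprod /= !big_cons mulrA. Qed.

Definition level d : R := \sum_(A : {set I} | #|A| == d) sqnorm (setprod A).

(** The k-th rising moment of the degree in [linform (v i)] of the product over A,
summed over all A of size d and all i outside A. *)
Definition moment k d : R :=
  \sum_(A : {set I} | #|A| == d) \sum_(i in ~: A) sqnorm (linform (v i) ^+ k * setprod A).

Lemma level0 : level 0 = 1.
Proof.
rewrite /level (big_pred1 set0) => [|A]; last by rewrite cards_eq0.
by rewrite setprodE big_set0 sqnorm1.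
Qed.

(* Otherwise unification expands products and inner products. *)
Local Opaque setprod sqnorm.

Lemma level_gt_card d : (#|I| < d)%N -> level d = 0.
Proof. by move=> ltd; rewrite /level big1 // => A /eqP cA; have := max_card A; lia. Qed.

Lemma moment0 d : moment 0 d = (#|I| - d)%:R * level d.
Proof.
rewrite /moment /level mulr_sumr; apply: eq_bigr => A /eqP cA.
under eq_bigr => i _ do rewrite expr0 mul1r.
by rewrite sumr_const mulr_natl cardsCs setCK cA.
Qed.

Lemma moment1 d : moment 1 d = d.+1%:R * level d.+1.
Proof.
rewrite /level mulr_sumr.
transitivity (\sum_(A : {set I} | #|A| == d.+1) \sum_(i in A) sqnorm (setprod A)).
  rewrite exchange_setT; apply: eq_bigr => A _; apply: eq_bigr => i; rewrite inE => iA.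
  by rewrite expr1 (setprodU1 iA).
by apply: eq_bigr => A /eqP cA; rewrite sumr_const cA mulr_natl.
Qed.

(** A form with index outside A enlarges A; one with index in A is squared. *)
Lemma sum_sqnorm_level d :
  \sum_(A : {set I} | #|A| == d.+1) \sum_i sqnorm (linform (v i) * setprod A)
  = d.+2%:R * level d.+2 + moment 2 d.
Proof.
rewrite -moment1 /moment.
under eq_bigr => A _ do rewrite (bigID (mem A)) /=.
rewrite big_split /= addrC; congr (_ + _).
  by apply: eq_bigr => A _; apply: eq_big => i; rewrite ?inE ?expr1.
rewrite exchange_setT; apply: eq_bigr => A _; apply: eq_bigr => i; rewrite inE => iA.
by rewrite (setprodU1 iA) mulrA.
Qed.

Lemma moment2S d : d.+1%:R * moment 2 d.+1
  = \sum_(A : {set I} | #|A| == d) \sum_(j in ~: A) \sum_(i in ~: A :\ j)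
      sqnorm (linform (v i) * (linform (v j) ^+ 2 * setprod A)).
Proof.
transitivity (\sum_(A : {set I} | #|A| == d.+1) \sum_(i in A) \sum_(j in ~: A)
                sqnorm (linform (v j) ^+ 2 * setprod A)).
  rewrite /moment mulr_sumr; apply: eq_bigr => A /eqP cA.
  by rewrite sumr_const cA mulr_natl.
rewrite exchange_setT; apply: eq_bigr => A _; rewrite [RHS]exchange_distinct.
apply: eq_bigr => i; rewrite inE => iA; rewrite (setprodU1 iA).
apply: eq_big => [j|j _]; last by rewrite mulrCA.
by rewrite !inE negb_or.
Qed.

(** The sum left over in [sum_sqnorm_moment2], when a second form gets squared. *)
Definition moment22 d : R :=
  \sum_(A : {set I} | #|A| == d) \sum_(j in ~: A) \sum_(i in ~: A :\ j)
    sqnorm (linform (v i) ^+ 2 * (linform (v j) ^+ 2 * setprod A)).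

(** [sqnorm_sq_ge] for the mode i and the product with j squared. *)
Lemma moment22_ge d :
  4 * d.+1%:R * moment 2 d.+1 - 2 * (#|I| - d.+1)%:R * moment 2 d <= moment22 d.
Proof.
rewrite -mulrA moment2S /moment /moment22 !mulr_sumr -sumrB; apply: ler_sum => A /eqP cA.
rewrite !mulr_sumr -sumrB; apply: ler_sum => j jA.
have -> : (#|I| - d.+1)%N = #|~: A :\ j|.
  by have := cardsD1 j (~: A); rewrite jA cardsCs setCK cA; lia.
rewrite -mulrA [_%:R * sqnorm _]mulr_natl -sumr_const !mulr_sumr -sumrB; apply: ler_sum => i _.
by rewrite sqr_linprod sqnorm_sq_ge.
Qed.

(** The index i of the new form can be j, a new index, or an element of A. *)
Lemma sum_sqnorm_moment2 d :
  \sum_(A : {set I} | #|A| == d.+1) \sum_(j in ~: A)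
    \sum_i sqnorm (linform (v i) * (linform (v j) ^+ 2 * setprod A))
  = moment 3 d.+1 + d.+2%:R * moment 2 d.+2 + moment22 d.
Proof.
have -> : moment22 d = \sum_(A : {set I} | #|A| == d.+1) \sum_(j in ~: A)
    \sum_(i in A) sqnorm (linform (v i) * (linform (v j) ^+ 2 * setprod A)).
  under [RHS]eq_bigr => A _ do rewrite exchange_big.
  rewrite exchange_setT; apply: eq_bigr => A _; rewrite [LHS]exchange_distinct.
  apply: eq_bigr => i; rewrite inE => iA; rewrite (setprodU1 iA).
  apply: eq_big => [j|j _]; first by rewrite !inE negb_or.
  by congr sqnorm; rewrite expr2; ring.
rewrite moment2S /moment -!big_split; apply: eq_bigr => A _ /=.
rewrite -!big_split; apply: eq_bigr => j jA /=.
rewrite (bigID (mem A)) /= addrC; congr (_ + _).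
rewrite (bigD1 j) /=; last by move: jA; rewrite inE.
rewrite mulrA -exprS; congr (_ + _).
by apply: eq_bigl => i; rewrite !inE andbC.
Qed.

Lemma moment2_ge d : 4 * moment 1 d - 2 * moment 0 d <= moment 2 d.
Proof.
rewrite /moment !mulr_sumr -sumrB; apply: ler_sum => A _.
rewrite !mulr_sumr -sumrB; apply: ler_sum => i _.
by rewrite expr1 expr0 mul1r sqnorm_sq_ge.
Qed.

Lemma moment2_ge_integral d : 6 * (moment 1 d - moment 0 d) <= moment 2 d.
Proof.
rewrite /moment -sumrB mulr_sumr; apply: ler_sum => A _.
rewrite -sumrB mulr_sumr; apply: ler_sum => i _.
by rewrite expr1 expr0 mul1r sqnorm_sq_ge_integral.
Qed.

Lemma moment2_le1 : moment 2 1 <= 4 * moment 1 1 - 2 * moment 0 1.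
Proof.
rewrite /moment !mulr_sumr -sumrB; apply: ler_sum => A /eqP cA.
rewrite !mulr_sumr -sumrB; apply: ler_sum => i _.
by rewrite expr1 expr0 mul1r sqnorm_sq_le_size1 // size_setprod.
Qed.

Section Overlap.

Variable b : I -> I -> R.
Hypothesis vb : forall i j, `|hdot (v i) (v j)| ^+ 2 = (b i j)%:C%C.

(** Up to d!, the total of the top masses of the distributions entering
[moment k d], where b i j is the squared modulus of the inner product of v i and v j. *)
Definition overlap d : R :=
  \sum_(A : {set I} | #|A| == d) \sum_(i in ~: A) \prod_(j in A) b j i.

Lemma overlap_top A i :
  (#|A|`!%:R * \prod_(j in A) b j i)%:C%C
  = (size [seq v j | j <- enum A])`!%:R
    * \prod_(u <- [seq v j | j <- enum A]) `|hdot u (v i)| ^+ 2.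
Proof.
rewrite size_setprod rmorphM rmorph_nat rmorph_prod big_map big_enum /=.
by congr (_ * _); apply: eq_bigr => j _; rewrite vb.
Qed.

Lemma moment2_2 : moment 2 2 = 4 * moment 1 2 - 2 * moment 0 2 + 4 * overlap 2.
Proof.
rewrite /moment /overlap !mulr_sumr -sumrB -big_split; apply: eq_bigr => A /eqP cA /=.
rewrite !mulr_sumr -sumrB -big_split; apply: eq_bigr => i _ /=.
rewrite expr1 expr0 mul1r (sqnorm_sq_size2 (v1 i) (overlap_top A i)) ?size_setprod //.
by rewrite cA (_ : 2`! = 2)%N //; ring.
Qed.

Lemma moment3_2 : moment 3 2 = 18 * moment 1 2 - 12 * moment 0 2 + 36 * overlap 2.
Proof.
rewrite /moment /overlap !mulr_sumr -sumrB -big_split; apply: eq_bigr => A /eqP cA /=.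
rewrite !mulr_sumr -sumrB -big_split; apply: eq_bigr => i _ /=.
rewrite expr1 expr0 mul1r (sqnorm_cube_size2 (v1 i) (overlap_top A i)) ?size_setprod //.
by rewrite cA (_ : 2`! = 2)%N //; ring.
Qed.

Lemma moment2_le d :
  moment 2 d <= 2 * moment 0 d + d.+2%:R * (moment 1 d - moment 0 d)
                + (d * d`!)%:R * overlap d.
Proof.
rewrite /moment /overlap -sumrB !mulr_sumr -!big_split; apply: ler_sum => A /eqP cA /=.
rewrite -sumrB !mulr_sumr -!big_split; apply: ler_sum => i _ /=.
have := sqnorm_sq_le (v1 i) (overlap_top A i); rewrite size_setprod cA.
by rewrite expr1 expr0 mul1r natrM -mulrA.
Qed.

Lemma overlapE d : overlap d = \sum_i elemsym [set~ i] (b^~ i) d.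
Proof.
rewrite /overlap (exchange_big_dep xpredT) //=; apply: eq_bigr => i _.
by apply: eq_bigl => A; rewrite subsetC sub1set andbC.
Qed.

End Overlap.

End Moments.

(** * Recursions for the level sums *)

Section Recursions.

Variables (R : rcfType) (n : nat) (I : finType) (v : I -> 'rV[R[i]]_n) (lam : R).
Hypothesis v1 : forall i, hdot (v i) (v i) = 1.
Local Notation Q := (level v).
Local Notation M := (moment v).

Section Tight.

Hypothesis tight : forall j, \sum_i hdot (v j) (v i) *: v i = lam%:C%C *: v j.

Lemma level_tight d :
  d.+2%:R * Q d.+2 + M 2 d = (#|I|%:R + lam * d.+1%:R) * Q d.+1.
Proof.
rewrite -sum_sqnorm_level /level mulr_sumr; apply: eq_bigr => A /eqP cA.
by rewrite /setprod (sum_sqnorm_tight v1 _ tight) -cardE cA.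
Qed.

Lemma moment2_tight d :
  M 3 d.+1 + d.+2%:R * M 2 d.+2 + moment22 v d
  = (#|I|%:R + lam * d.+3%:R) * M 2 d.+1.
Proof.
rewrite -sum_sqnorm_moment2 /moment mulr_sumr; apply: eq_bigr => A /eqP cA.
rewrite mulr_sumr; apply: eq_bigr => j _.
by rewrite sqr_linprod (sum_sqnorm_tight v1 _ tight) [size _]/= -cardE cA.
Qed.

End Tight.

Lemma level_bessel (b : I -> I -> R) d :
    0 < lam -> (forall i j, 0 <= b i j) -> (forall i j, b i j = b j i) ->
    (forall i j, hdot (v i) (v j) = (b i j)%:C%C) ->
    (forall i, \sum_j b i j = lam) ->
  d.+2%:R * Q d.+2 + M 2 d <= (#|I|%:R + lam * d.+1%:R) * Q d.+1.
Proof.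
move=> lam0 b0 bC vb bsum.
rewrite -sum_sqnorm_level /level mulr_sumr; apply: ler_sum => A /eqP cA.
have := sum_sqnorm_bessel v1 [seq v i | i <- enum A] lam0 b0 bC vb bsum.
by rewrite size_setprod cA.
Qed.

End Recursions.

Section OverlapBounds.

Variables (R : rcfType) (I : finType) (b : I -> I -> R) (r : R).
Hypothesis b0 : forall i j, 0 <= b i j.
Hypothesis bsum : forall i, \sum_(j in [set~ i]) b j i = r.

Definition sqsum : R := \sum_i \sum_(j in [set~ i]) b j i ^+ 2.

(** The square of the i-th row sum, split into its diagonal and off-diagonal terms. *)
Lemma overlap2E : 2 * overlap b 2 + sqsum = #|I|%:R * r ^+ 2.
Proof.
rewrite overlapE mulr_sumr -big_split /=.
rewrite mulr_natl -sumr_const; apply: eq_bigr => i _.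
have := elemsym_step [set~ i] (b^~ i) 1.
rewrite sum_subset1 elemsym1 bsum -expr2 => ->; rewrite addrC; congr (_ + _).
by apply: eq_bigr => k _; rewrite !big_set1.
Qed.

Lemma overlap_step d :
  d.+2%:R * #|I|.-1%:R * overlap b d.+2 <= (#|I|.-1 - d.+1)%:R * r * overlap b d.+1.
Proof.
rewrite !overlapE !mulr_sumr; apply: ler_sum => i _.
rewrite -(bsum i) -elemsym1 -(cardsC1 i).
by apply: elemsym_maclaurin.
Qed.

End OverlapBounds.

(** * Nine vectors: lower bound for a tight frame *)

(** Here q_d, m_d, e_d stand for level d, moment 2 d, overlap d, and y, z for
moment 3 2 and moment22 1. Minimizing q9 under these linear constraints gives
6.9047... - 0.0829... e2; the bound stated is a rounding. Level 5 is reached through y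
and z, and the later ones through the overlaps. *)
Lemma tight_recursion_bound (R : realFieldType)
    (q0 q1 q2 q3 q4 q5 q6 q7 q8 q9 q10 m0 m1 m2 m3 m5 m6 m7 m8 y z f8 : R)
    (e0 e2 e3 e4 e5 e6 e7 e8 : R) :
    q0 = 1 -> q1 = 9 -> q10 = 0 -> f8 = 8 * 5040 -> 0 <= e2 ->
    2 * q2 + m0 = (9 + 9 / 4 * 1) * q1 -> 3 * q3 + m1 = (9 + 9 / 4 * 2) * q2 ->
    4 * q4 + m2 = (9 + 9 / 4 * 3) * q3 -> 5 * q5 + m3 = (9 + 9 / 4 * 4) * q4 ->
    7 * q7 + m5 = (9 + 9 / 4 * 6) * q6 -> 8 * q8 + m6 = (9 + 9 / 4 * 7) * q7 ->
    9 * q9 + m7 = (9 + 9 / 4 * 8) * q8 -> 10 * q10 + m8 = (9 + 9 / 4 * 9) * q9 ->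
    y + 3 * m3 + z = (9 + 9 / 4 * 4) * m2 -> 4 * 2 * m2 - 2 * 7 * m1 <= z ->
    m0 <= 2 * (9 * q0) + 2 * (1 * q1 - 9 * q0) + 0 * 1 * e0 ->
    m1 <= 4 * (2 * q2) - 2 * (8 * q1) ->
    m2 = 4 * (3 * q3) - 2 * (7 * q2) + 4 * e2 ->
    y = 18 * (3 * q3) - 12 * (7 * q2) + 36 * e2 ->
    m5 <= 2 * (4 * q5) + 7 * (6 * q6 - 4 * q5) + 5 * 120 * e5 ->
    m6 <= 2 * (3 * q6) + 8 * (7 * q7 - 3 * q6) + 6 * 720 * e6 ->
    m7 <= 2 * (2 * q7) + 9 * (8 * q8 - 2 * q7) + 7 * 5040 * e7 ->
    m8 <= 2 * (1 * q8) + 10 * (9 * q9 - 1 * q8) + 8 * f8 * e8 ->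
    3 * 8 * e3 <= 6 * (5 / 4) * e2 -> 4 * 8 * e4 <= 5 * (5 / 4) * e3 ->
    5 * 8 * e5 <= 4 * (5 / 4) * e4 -> 6 * 8 * e6 <= 3 * (5 / 4) * e5 ->
    7 * 8 * e7 <= 2 * (5 / 4) * e6 -> 8 * 8 * e8 <= 1 * (5 / 4) * e7 ->
  69 / 10 - e2 / 12 <= q9.
Proof. by move=> -> -> -> -> *; lra. Qed.

Section Nine.

Variables (R : rcfType) (n : nat) (v : 'I_9 -> 'rV[R[i]]_n) (b : 'I_9 -> 'I_9 -> R).
Hypothesis v1 : forall i, hdot (v i) (v i) = 1.
Hypothesis b0 : forall i j, 0 <= b i j.
Hypothesis bsum : forall i, \sum_(j in [set~ i]) b j i = 5 / 4.
Local Notation Q := (level v).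
Local Notation M := (moment v).
Local Notation E := (overlap b).

Lemma moment0_9 d : M 0 d = (9 - d)%:R * Q d. Proof. by rewrite moment0 card_ord. Qed.

Lemma sqnorm_setprod1 k : sqnorm (setprod v [set k]) = 1.
Proof.
rewrite setprodE big_set1 -[linform _]mulr1 sqnorm_linform // sqnorm1 -mpolyC1 pderivC.
by rewrite /sqnorm fock0l addr0.
Qed.

Lemma level1 : Q 1 = 9.
Proof.
rewrite /level (eq_bigl (fun A : {set 'I_9} => (A \subset setT) && (#|A| == 1))); last first.
  by move=> A; rewrite subsetT.
rewrite sum_subset1; under eq_bigr => k _ do rewrite sqnorm_setprod1.
by rewrite sumr_const cardsT card_ord.
Qed.

Lemma tight_level9_ge :
    (forall i j, `|hdot (v i) (v j)| ^+ 2 = (b i j)%:C%C) ->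
    (forall j, \sum_i hdot (v j) (v i) *: v i = (9 / 4)%:C%C *: v j) ->
  69 / 10 - E 2 / 12 <= Q 9.
Proof.
move=> vb tight.
have q10 : Q 10 = 0 by rewrite level_gt_card ?card_ord.
have r d : d.+2%:R * Q d.+2 + M 2 d = (9 + 9 / 4 * d.+1%:R) * Q d.+1.
  by have := level_tight v1 tight d; rewrite card_ord.
have s d : d.+2%:R * 8 * E d.+2 <= (8 - d.+1)%:R * (5 / 4) * E d.+1.
  by have := overlap_step b0 bsum d; rewrite card_ord.
have t d : M 2 d <= 2 * ((9 - d)%:R * Q d)
    + d.+2%:R * (d.+1%:R * Q d.+1 - (9 - d)%:R * Q d) + d%:R * d`!%:R * E d.
  by rewrite -moment0_9 -moment1 -natrM; apply: moment2_le.
have e0 : 0 <= E 2 by apply: sumr_ge0 => A _; apply: sumr_ge0 => i _; apply: prodr_ge0.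
have x1 : M 2 1 <= 4 * (2 * Q 2) - 2 * (8 * Q 1).
  by rewrite -(moment0_9 1) -(moment1 v 1) moment2_le1.
have x2 : M 2 2 = 4 * (3 * Q 3) - 2 * (7 * Q 2) + 4 * E 2.
  by rewrite -(moment0_9 2) -(moment1 v 2) (moment2_2 v1 vb).
have y2 : M 3 2 = 18 * (3 * Q 3) - 12 * (7 * Q 2) + 36 * E 2.
  by rewrite -(moment0_9 2) -(moment1 v 2) (moment3_2 v1 vb).
have z1 : 4 * 2 * M 2 2 - 2 * 7 * M 2 1 <= moment22 v 1.
  by have := moment22_ge v1 1; rewrite card_ord.
have rz : M 3 2 + 3 * M 2 3 + moment22 v 1 = (9 + 9 / 4 * 4) * M 2 2.
  by have := moment2_tight v1 tight 1; rewrite card_ord.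
have f8 : 8`!%:R = 8 * 5040 :> R by rewrite factS natrM.
exact: (tight_recursion_bound (level0 v) level1 q10 f8 e0 (r 0) (r 1) (r 2) (r 3) (r 5)
  (r 6) (r 7) (r 8) rz z1 (t 0) x1 x2 y2 (t 5) (t 6) (t 7) (t 8) (s 1) (s 2) (s 3) (s 4)
  (s 5) (s 6)).
Qed.

End Nine.

(** * Nine vectors: upper bound for a nonnegative Gram matrix *)

(** As in [tight_recursion_bound], with s the sum of the squares of the b i j. The
exact maximum of q9 is 48.7818... - 2.1530... e2. The integrality bounds, with factor 6,
serve at the last two levels, where the extremal degree m averages between 1 and 2. *)
Lemma bessel_recursion_bound (R : realFieldType)
    (q2 q3 q4 q5 q6 q7 q8 q9 q10 m2 m3 m5 m6 m7 m8 e2 s : R) :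
    q10 = 0 -> 0 <= e2 -> 2 * e2 + s = 9 * (5 / 4) ^+ 2 ->
    2 * q2 = 72 + s -> 3 * q3 <= 7 * q2 + 7 * s + 2 * e2 ->
    4 * q4 + m2 <= (9 + 9 / 4 * 3) * q3 -> 5 * q5 + m3 <= (9 + 9 / 4 * 4) * q4 ->
    7 * q7 + m5 <= (9 + 9 / 4 * 6) * q6 -> 8 * q8 + m6 <= (9 + 9 / 4 * 7) * q7 ->
    9 * q9 + m7 <= (9 + 9 / 4 * 8) * q8 -> 10 * q10 + m8 <= (9 + 9 / 4 * 9) * q9 ->
    4 * (3 * q3) - 2 * (7 * q2) <= m2 -> 4 * (4 * q4) - 2 * (6 * q3) <= m3 ->
    4 * (6 * q6) - 2 * (4 * q5) <= m5 -> 4 * (7 * q7) - 2 * (3 * q6) <= m6 ->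
    6 * (8 * q8 - 2 * q7) <= m7 -> 6 * (9 * q9 - 1 * q8) <= m8 ->
  q9 <= 244 / 5 - 107 / 50 * e2.
Proof.
move=> -> e0; rewrite (_ : 9 * (5 / 4) ^+ 2 = 225 / 16 :> R); last by field.
by move=> *; lra.
Qed.

Section NineUpper.

Variables (R : rcfType) (n : nat) (v : 'I_9 -> 'rV[R[i]]_n) (b : 'I_9 -> 'I_9 -> R).
Hypothesis v1 : forall i, hdot (v i) (v i) = 1.
Hypothesis vb : forall i j, hdot (v i) (v j) = (b i j)%:C%C.
Hypothesis b0 : forall i j, 0 <= b i j.
Hypothesis bC : forall i j, b i j = b j i.
Hypothesis btot : forall i, \sum_j b i j = 9 / 4.
Local Notation Q := (level v).
Local Notation M := (moment v).
Local Notation E := (overlap b).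

Lemma bessel_bii i : b i i = 1.
Proof. by apply: (@complexI R); rewrite -vb v1. Qed.

Lemma bessel_bsum i : \sum_(j in [set~ i]) b j i = 5 / 4.
Proof.
have := btot i; rewrite (bigD1 i) //= bessel_bii => h.
rewrite (eq_big (fun j => j != i) (b i)); [lra|by move=> j; rewrite !inE|by move=> j _].
Qed.

Lemma moment1D d : M 1 d = M 0 d
  + \sum_(A : {set 'I_9} | #|A| == d) \sum_(i in ~: A) sqnorm (pderiv (v i) (setprod v A)).
Proof.
rewrite /moment -big_split; apply: eq_bigr => A _ /=; rewrite -big_split.
by apply: eq_bigr => i _; rewrite expr1 expr0 mul1r sqnorm_linform.
Qed.

Lemma bessel_level2 : 2 * Q 2 = 72 + sqsum b.
Proof.
rewrite -(moment1 v 1) moment1D moment0 card_ord (level1 v1) -natrM; congr (_ + _).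
rewrite (eq_bigl (fun A : {set 'I_9} => (A \subset setT) && (#|A| == 1))); last first.
  by move=> A; rewrite subsetT.
rewrite (sum_subset1 setT (fun A => \sum_(i in ~: A) sqnorm (pderiv (v i) (setprod v A)))).
rewrite /sqsum; apply: eq_big => [i|k _]; first by rewrite inE.
apply: eq_bigr => i _; rewrite setprodE big_set1 pderiv_linform vb -[_%:MP]mulr1 mul_mpolyC.
by rewrite sqnormZ sqnorm1 mulr1 bC.
Qed.

(** The derivative is b j i *: linform (v k) + b k i *: linform (v j), and the inner
product of two unit forms is at most one. *)
Lemma sqnorm_pderiv2_le (A : {set 'I_9}) i : #|A| == 2 ->
  sqnorm (pderiv (v i) (setprod v A)) <= \sum_(j in A) b j i ^+ 2 + 2 * \prod_(j in A) b j i.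
Proof.
move=> /cards2P[j [k [jk ->]]].
rewrite setprodE !big_setU1 ?inE //= !big_set1 pderivM !pderiv_linform !vb.
rewrite [linform (v j) * _]mulrC !mul_mpolyC.
have fl l : sqnorm (linform (v l)) = 1 by rewrite -(sqnorm_setprod1 v1 l) setprodE big_set1.
set x := _ *: _; set y := _ *: _; set bj := b j i; set bk := b k i.
have xy : refock x y = bj * bk * refock (linform (v k)) (linform (v j)).
  rewrite /refock fockZl fockZr conj_Creal ?complex_real // mulrA -rmorphM.
  by case: (fock _ _) => p q /=; rewrite mul0r subr0.
rewrite sqnormD !sqnormZ !fl xy -/bj -/bk.
have := refock_le (linform (v k)) (linform (v j)); rewrite !fl => h.
have h' : refock (linform (v k)) (linform (v j)) <= 1 by lra.
have : bj * bk * refock (linform (v k)) (linform (v j)) <= bj * bk.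
  by rewrite -[leRHS]mulr1; apply: ler_wpM2l => //; apply: mulr_ge0; exact: b0.
by lra.
Qed.

Lemma sum_sq_overlap : \sum_(A : {set 'I_9} | #|A| == 2) \sum_(i in ~: A)
  \sum_(j in A) b j i ^+ 2 = 7 * sqsum b.
Proof.
rewrite (exchange_big_dep xpredT) //= /sqsum mulr_sumr; apply: eq_bigr => i _.
rewrite (eq_bigl (fun A : {set 'I_9} => (A \subset [set~ i]) && (#|A| == 2))); last first.
  by move=> A; rewrite inE [in RHS]subsetC sub1set inE andbC.
rewrite (exchange_subset _ _ (fun j _ => b j i ^+ 2)).
rewrite (sum_subset1 _ (fun A => \sum_(j in [set~ i] :\: A) b j i ^+ 2)).
rewrite exchange_distinct mulr_sumr; apply: eq_bigr => j ji.
rewrite sumr_const (_ : #|_| = 7) ?mulr_natl //.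
by have := cardsD1 j [set~ i]; rewrite ji cardsC1 card_ord => -[].
Qed.

(** Computing the derivatives of products of two forms exactly, as b is nonnegative,
is much sharper here than [level_bessel]. *)
Lemma bessel_level3 : 3 * Q 3 <= 7 * Q 2 + 7 * sqsum b + 2 * E 2.
Proof.
rewrite -(moment1 v 2) moment1D moment0 card_ord -addrA lerD2l.
rewrite -sum_sq_overlap /overlap mulr_sumr -big_split; apply: ler_sum => A cA /=.
rewrite mulr_sumr -big_split; apply: ler_sum => i _ /=.
exact: sqnorm_pderiv2_le.
Qed.

Lemma bessel_level9_le : Q 9 <= 244 / 5 - 107 / 50 * E 2.
Proof.
have q10 : Q 10 = 0 by rewrite level_gt_card ?card_ord.
have lam0 : 0 < 9 / 4 :> R by lra.
have r d : d.+2%:R * Q d.+2 + M 2 d <= (9 + 9 / 4 * d.+1%:R) * Q d.+1.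
  by have := level_bessel v1 d lam0 b0 bC vb btot; rewrite card_ord.
have t d : 4 * (d.+1%:R * Q d.+1) - 2 * ((9 - d)%:R * Q d) <= M 2 d.
  by rewrite -moment0_9 -moment1 moment2_ge.
have u d : 6 * (d.+1%:R * Q d.+1 - (9 - d)%:R * Q d) <= M 2 d.
  by rewrite -moment0_9 -moment1 moment2_ge_integral.
have e0 : 0 <= E 2 by apply: sumr_ge0 => A _; apply: sumr_ge0 => i _; apply: prodr_ge0.
have es : 2 * E 2 + sqsum b = 9 * (5 / 4) ^+ 2.
  by rewrite (overlap2E bessel_bsum) card_ord.
exact: (bessel_recursion_bound q10 e0 es bessel_level2 bessel_level3 (r 2) (r 3) (r 5) (r 6)
  (r 7) (r 8) (t 2) (t 3) (t 5) (t 6) (u 7) (u 8)).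
Qed.

(** Squaring decreases numbers between 0 and 1, so by [overlap2E] the overlaps keep a
positive share of the squared row sums. *)
Lemma overlap2_ge : (forall i j, b i j <= 1) -> 45 / 32 <= E 2.
Proof.
move=> b1; have es : 2 * E 2 + sqsum b = 9 * (5 / 4) ^+ 2.
  by rewrite (overlap2E bessel_bsum) card_ord.
have : sqsum b <= \sum_(i < 9) (5 / 4).
  apply: ler_sum => i _; rewrite -(bessel_bsum i); apply: ler_sum => j _.
  by rewrite expr2 ler_piMr.
rewrite sumr_const card_ord => h.
have {}es : 2 * E 2 + sqsum b = 225 / 16 by rewrite es; field.
by lra.
Qed.

End NineUpper.

(** The ratio of the two bounds is largest at e = 45/32, where x is at most 45.80 and y is at least 6.78. *)
Lemma ratio_bound (R : realFieldType) (e x y : R) :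
  45 / 32 <= e -> e <= 225 / 32 -> x <= 244 / 5 - 107 / 50 * e -> 69 / 10 - e / 12 <= y ->
  x <= 999 / 1000 * y ^+ 2.
Proof.
move=> e1 e2 hx hy.
have : (69 / 10 - e / 12) ^+ 2 <= y ^+ 2 by rewrite ler_sqr ?nnegrE //; lra.
set z := 69 / 10 - e / 12 => hz.
suff : x <= 999 / 1000 * z ^+ 2 by lra.
have : 0 <= (e - 45 / 32) * (225 / 32 - e) by apply: mulr_ge0; lra.
rewrite /z !expr2; nra.
Qed.

(** * Permanents as squared norms, and tightness as an equation *)

Section Permanent.

(** [lift_perm] enumerates 'S_N.+1 by the image j of 0 and a permutation in 'S_N: it is
injective, and the cardinals agree. *)
Lemma per_expand (R : comNzRingType) N (M : 'M[R]_N.+1) :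
  per M = \sum_j M ord0 j * per (row' ord0 (col' j M)).
Proof.
have bij : bijective (fun p : 'I_N.+1 * 'S_N => lift_perm ord0 p.1 p.2).
  apply: inj_card_bij => [[j s] [j' s'] /= e|]; last first.
    by rewrite card_prod !card_Sn card_ord factS.
  have jj : j = j' by rewrite -(lift_perm_id ord0 j s) e lift_perm_id.
  rewrite -{}jj in e *; congr (_, _); apply/permP => k.
  by apply: (@lift_inj _ j); rewrite -!(lift_perm_lift ord0) e.
rewrite /per (reindex _ (onW_bij _ bij)) /=.
rewrite -(pair_bigA _ (fun j s => \prod_i M i (lift_perm ord0 j s i))) /=.
apply: eq_bigr => j _; rewrite mulr_sumr; apply: eq_bigr => s _.
rewrite big_ord_recl lift_perm_id; congr (_ * _).
by apply: eq_bigr => k _; rewrite lift_perm_lift !mxE.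
Qed.

Variables (C : numClosedFieldType) (n : nat).

Lemma pderiv_prod N (v : 'rV[C]_n) (w : 'I_N.+1 -> 'rV[C]_n) :
  pderiv v (\prod_j linform (w j))
  = \sum_j hdot (w j) v *: \prod_(k < N) linform (w (lift j k)).
Proof.
elim: N w => [|N IH] w.
  by rewrite !big_ord_recl !big_ord0 mulr1 addr0 pderiv_linform -[_%:MP]mulr1 mul_mpolyC.
rewrite big_ord_recl pderivM pderiv_linform mul_mpolyC IH [RHS]big_ord_recl.
congr (_ + _); rewrite mulr_sumr; apply: eq_bigr => j _.
rewrite -scalerAr; congr (_ *: _); rewrite big_ord_recl; congr (_ * _).
  by congr (linform (w _)); apply: val_inj.
by apply: eq_bigr => k _; congr (linform (w _)); apply: val_inj; rewrite /= /bump; lia.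
Qed.

(** Moving the first form to the other side as a derivative, the product rule
becomes the expansion of the permanent along its first row. *)
Lemma fock_prod_per N (u w : 'I_N -> 'rV[C]_n) :
  fock (\prod_i linform (u i)) (\prod_j linform (w j))
  = per (\matrix_(i, j) hdot (u i) (w j)).
Proof.
elim: N u w => [|N IH] u w.
  rewrite !big_ord0 fock11 /per (big_pred1 1%g) ?big_ord0 // => s.
  by apply/esym/eqP/permP => -[].
rewrite big_ord_recl fock_linform pderiv_prod fock_sumr per_expand.
apply: eq_bigr => j _; rewrite fockZr IH mxE -hdotC; congr (_ * per _).
by apply/matrixP => i k; rewrite !mxE.
Qed.

End Permanent.

Section Spectral.

Variable C : numClosedFieldType.

(** A Hermitian matrix is diagonalizable, and the eigenvalues 0 and 9/4 are roots of
x^2 = (9/4) x. *)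
Lemma rank4_tight_sqr (A : 'M[C]_9) : rank4_tight A -> A *m A = (9 / 4) *: A.
Proof.
move=> [[[Aherm _] _] eigA _].
have /orthomx_spectralP eA := hermitian_normalmx Aherm.
set P := spectralmx A in eA; set sp := spectral_diag A in eA.
have Pu : P \in unitmx by apply/unitarymx_unit/spectral_unitarymx.
have PA : P *m A = diag_mx sp *m P by rewrite [in LHS]eA !mulmxA mulmxV // mul1mx.
have spE k : sp 0 k * sp 0 k = 9 / 4 * sp 0 k.
  have [->|nz] := eqVneq (sp 0 k) 0; first by rewrite !mulr0.
  congr (_ * _); apply: (eigA _ _ nz); apply/eigenvalueP; exists (row k P).
    by rewrite -row_mul PA row_mul row_diag_mx -scalemxAl -rowE.
  apply/eqP => r0; have := row_free_unit P; rewrite Pu => /row_freeP[B PB].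
  have /rowP/(_ k) : row k (P *m B) = 0 by rewrite row_mul r0 mul0mx.
  by rewrite PB !mxE eqxx => /eqP; rewrite oner_eq0.
have dd : diag_mx sp *m diag_mx sp = (9 / 4) *: diag_mx sp.
  rewrite mulmx_diag -linearZ; congr diag_mx; apply/rowP => k.
  by rewrite !mxE spE.
rewrite {1 2}eA !mulmxA -[_ *m P *m invmx P]mulmxA mulmxV // mulmx1.
rewrite -[_ *m diag_mx sp *m diag_mx sp]mulmxA dd -scalemxAr -scalemxAl.
by rewrite [in RHS]eA.
Qed.

End Spectral.

(** * Rank-four tight matrices and their rescalings *)

Section PermanentRatio.

Variable R : realType.
Local Notation C := R[i].

(** Stated for variables: rewriting directly in [rho9t] unfolds its unary numerals. *)
Lemma rmorph_rho (f : {rmorphism R -> C}) (a b c d t : R) :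
  f ((a * t ^+ 9 + b * t ^+ 6 + c * t ^+ 3 + d) / t ^+ 12)
  = (f a * f t ^+ 9 + f b * f t ^+ 6 + f c * f t ^+ 3 + f d) / f t ^+ 12.
Proof. by rewrite fmorph_div !rmorphD (rmorphM f a) (rmorphM f b) (rmorphM f c) !rmorphXn. Qed.

Lemma rho9t_complex : (rho9t R)%:C%C = rho9t C.
Proof. by rewrite /rho9t (rmorph_rho (real_complex R)) !rmorph_nat. Qed.

Lemma rho9t_ge : 999 / 1000 <= rho9t R.
Proof.
rewrite /rho9t ler_pdivlMr ?exprn_gt0 //; set t := 10 : R.
have -> : t ^+ 12 = t ^+ 9 * 1000 by rewrite (exprD t 9 3) /t; congr (_ * _); ring.
have : 0 <= t ^+ 9 by rewrite exprn_ge0.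
have : 0 <= t ^+ 6 by rewrite exprn_ge0.
have : 0 <= t ^+ 3 by rewrite exprn_ge0.
by lra.
Qed.

Lemma rho9t_lt1 : rho9t R < 1.
Proof.
rewrite /rho9t ltr_pdivrMr ?exprn_gt0 // mul1r; set t := 10 : R.
have t3 : t ^+ 3 = 1000 by rewrite /t; ring.
rewrite (exprD t 9 3) (exprD t 6 3) (exprD t 3 3) !t3.
by lra.
Qed.

Lemma level9_per n (v : 'I_9 -> 'rV[C]_n) :
  (level v 9)%:C%C = per (\matrix_(i, j) hdot (v i) (v j)).
Proof.
rewrite /level (big_pred1 setT) => [|A]; last first.
  have := subset_leq_card (subsetT A); rewrite cardsT card_ord => le9.
  by rewrite /= eqEcard subsetT cardsT card_ord /= eqn_leq le9.
rewrite -fockE -fock_prod_per setprodE.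
by congr (fock _ _); apply: eq_bigl => i; rewrite inE.
Qed.

Lemma hdot_tensor n (x y : 'rV[C]_n) :
  hdot (mxvec (x^T *m map_mx Num.conj x)) (mxvec (y^T *m map_mx Num.conj y))
  = `|hdot x y| ^+ 2.
Proof.
rewrite normCK /hdot rmorph_sum mulr_suml (reindex _ (curry_mxvec_bij _ _)) /=.
pose F k l := mxvec (x^T *m map_mx Num.conj x) 0 (mxvec_index k l)
  * (mxvec (y^T *m map_mx Num.conj y) 0 (mxvec_index k l))^*.
rewrite (eq_bigr (fun p => F p.1 p.2)) => [|[k l] _ //]; rewrite -(pair_bigA _ F) /F /=.
apply: eq_bigr => k _; rewrite mulr_sumr; apply: eq_bigr => l _.
by rewrite !mxvecE !mxE !big_ord1 !mxE !rmorphM mulrACA.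
Qed.

Lemma hermsymmx_conj N (A : 'M[C]_N) : A \is hermsymmx -> forall i j, (A i j)^* = A j i.
Proof. by move=> /is_hermitianmxP/matrixP Ah i j; rewrite (Ah j i) !mxE /= expr0 mul1r. Qed.

Section TightMatrix.

Variable A : 'M[C]_9.
Hypothesis At : rank4_tight A.

Definition overlapmx i j : R := complex.Re (A i j) ^+ 2 + complex.Im (A i j) ^+ 2.

Lemma tight_conj i j : (A i j)^* = A j i.
Proof. by have [[[Ah _] _] _ _] := At; apply: hermsymmx_conj. Qed.

Lemma tight_diag i : A i i = 1.
Proof. by have [[_ ->]] := At. Qed.

Lemma overlapmxE i j : `|A i j| ^+ 2 = (overlapmx i j)%:C%C.
Proof. by rewrite -add_Re2_Im2. Qed.

Lemma overlapmx_mul i j : A i j * A j i = (overlapmx i j)%:C%C.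
Proof. by rewrite -overlapmxE normCK tight_conj. Qed.

(** Since A is Hermitian and A^2 = (9/4) A, the Gram matrix of the rows of (2/3) A
is (4/9) A^2 = A. *)
Definition tightvec i : 'rV[C]_9 := (2 / 3) *: row i A.

(** The tensor product of [tightvec i] with its conjugate, in coordinates. *)
Definition tensorvec i : 'rV[C]_(9 * 9) :=
  mxvec ((tightvec i)^T *m map_mx Num.conj (tightvec i)).

Lemma hdot_tightvec i j : hdot (tightvec i) (tightvec j) = A i j.
Proof.
have /matrixP/(_ i j) := rank4_tight_sqr At; rewrite !mxE => h.
transitivity ((4 / 9) * \sum_k A i k * A k j); last by rewrite h; field.
rewrite /hdot mulr_sumr; apply: eq_bigr => k _; rewrite !mxE rmorphM /= tight_conj.
rewrite [(2 / 3)^*]conj_Creal ?realM ?realV ?realn //.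
by field.
Qed.

Lemma tightvec_frame j :
  \sum_i hdot (tightvec j) (tightvec i) *: tightvec i = (9 / 4)%:C%C *: tightvec j.
Proof.
apply/rowP => k; rewrite summxE !mxE.
have /matrixP/(_ j k) := rank4_tight_sqr At; rewrite !mxE => h.
have -> : (9 / 4)%:C%C = 9 / 4 :> C by rewrite rmorphM fmorphV !rmorph_nat.
rewrite mulrCA -h mulr_sumr; apply: eq_bigr => i _.
by rewrite hdot_tightvec !mxE mulrCA.
Qed.

Lemma hdot_tensorvec i j : hdot (tensorvec i) (tensorvec j) = (overlapmx i j)%:C%C.
Proof. by rewrite hdot_tensor hdot_tightvec overlapmxE. Qed.

Lemma overlapmx_ge0 i j : 0 <= overlapmx i j.
Proof. by rewrite addr_ge0 ?sqr_ge0. Qed.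

Lemma overlapmxC i j : overlapmx i j = overlapmx j i.
Proof. by apply: (@complexI R); rewrite -!overlapmx_mul mulrC. Qed.

Lemma overlapmx_sum i : \sum_j overlapmx i j = 9 / 4.
Proof.
apply: (@complexI R); rewrite rmorph_sum rmorphM fmorphV !rmorph_nat /=.
have /matrixP/(_ i i) := rank4_tight_sqr At; rewrite !mxE tight_diag mulr1 => <-.
by apply: eq_bigr => j _; rewrite overlapmx_mul.
Qed.

(** The component of [tightvec i] orthogonal to [tightvec j] has squared norm
1 - overlapmx i j. *)
Lemma overlapmx_le1 i j : overlapmx i j <= 1.
Proof.
set x := tightvec i - A i j *: tightvec j.
have : 0 <= hdot x x by apply: sumr_ge0 => k _; apply: mul_conjC_ge0.
have xE k : hdot x (tightvec k) = A i k - A i j * A j k.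
  by rewrite /x hdotBl (hdotZl (A i j)) !hdot_tightvec.
rewrite {1}/x hdotBl (hdotZl (A i j)) (hdotC x (tightvec i)) (hdotC x (tightvec j)) !xE.
rewrite !tight_diag mulr1 subrr conjC0 mulr0 subr0 overlapmx_mul rmorphB rmorph1 /=.
by rewrite conj_Creal ?complex_real // subr_ge0 -(rmorph1 (real_complex R)) lecR.
Qed.

Lemma tight_per : per A = (level tightvec 9)%:C%C.
Proof. by rewrite level9_per; congr per; apply/matrixP => i j; rewrite mxE hdot_tightvec. Qed.

Lemma tight_per_hadamard :
  per (hadamard A (map_mx Num.conj A)) = (level tensorvec 9)%:C%C.
Proof.
rewrite level9_per; congr per; apply/matrixP => i j.
by rewrite !mxE hdot_tensorvec -overlapmxE normCK.
Qed.

Lemma tight_level_bounds (e := overlap overlapmx 2) :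
  [/\ 45 / 32 <= e, e <= 225 / 32, level tensorvec 9 <= 244 / 5 - 107 / 50 * e
    & 69 / 10 - e / 12 <= level tightvec 9].
Proof.
have w1 i : hdot (tensorvec i) (tensorvec i) = 1.
  by rewrite hdot_tensorvec -overlapmx_mul tight_diag mulr1.
have bsum := bessel_bsum w1 hdot_tensorvec overlapmxC overlapmx_sum.
split.
- exact: (overlap2_ge w1 hdot_tensorvec overlapmx_ge0 overlapmxC overlapmx_sum overlapmx_le1).
- have := overlap2E bsum; rewrite card_ord -/e.
  have : 0 <= sqsum overlapmx by do 2!apply: sumr_ge0 => ? _; rewrite sqr_ge0.
  by lra.
- exact: (bessel_level9_le w1 hdot_tensorvec overlapmx_ge0 overlapmxC overlapmx_sum).
apply: (tight_level9_ge _ overlapmx_ge0 bsum _ tightvec_frame) => [i|i j].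
  by rewrite hdot_tightvec tight_diag.
by rewrite hdot_tightvec overlapmxE.
Qed.

Lemma tight_per_gt0 : 0 < per A.
Proof.
have [_ e2 _ lo] := tight_level_bounds.
by rewrite tight_per -(rmorph0 (real_complex R)) ltcR; lra.
Qed.

Lemma tight_per_ratio :
  per (hadamard A (map_mx Num.conj A)) <= rho9t C * per A ^+ 2.
Proof.
have [e1 e2 up lo] := tight_level_bounds.
rewrite tight_per tight_per_hadamard -rho9t_complex -rmorphXn -rmorphM lecR.
apply: le_trans (ratio_bound e1 e2 up lo) _.
by rewrite ler_wpM2r ?sqr_ge0 ?rho9t_ge.
Qed.

End TightMatrix.

Lemma normalization_scale (A : 'M[C]_9) : posdiag A ->
  exists2 d : 'I_9 -> C, (forall i, 0 < d i) &
    forall i j, A i j = d i * corr_normalization A i j * d j.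
Proof.
move=> Apos; exists (fun i => sqrtC (A i i)) => [i|i j]; first by rewrite sqrtC_gt0.
rewrite /corr_normalization; set D := diag_mx _.
have Du : D \in unitmx.
  rewrite unitmxE det_diag unitfE; apply/prodf_neq0 => k _.
  by rewrite mxE gt_eqF // sqrtC_gt0.
have {1}-> : A = D *m (invmx D *m A *m invmx D) *m D.
  by rewrite !mulmxA mulmxV // mul1mx -mulmxA mulVmx // mulmx1.
set B := invmx D *m A *m invmx D.
by rewrite mul_mx_diag mxE mul_diag_mx !mxE.
Qed.

Lemma hadamardE N (A B : 'M[C]_N) i j : hadamard A B i j = A i j * B i j.
Proof. by rewrite mxE. Qed.

Lemma per_scale N (d e : 'I_N -> C) (A B : 'M[C]_N) :
  (forall i j, A i j = d i * B i j * e j) ->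
  per A = (\prod_i d i) * (\prod_j e j) * per B.
Proof.
move=> AB; rewrite /per mulr_sumr; apply: eq_bigr => s _.
have -> : \prod_j e j = \prod_i e (s i) by rewrite (reindex_inj (@perm_inj _ s)).
by rewrite -!big_split; apply: eq_bigr => i _ /=; rewrite AB mulrAC.
Qed.

Lemma normalization_per_ratio (A : 'M[C]_9) :
    posdiag A -> rank4_tight (corr_normalization A) ->
  per (hadamard A (map_mx Num.conj A)) <= rho9t C * per A ^+ 2.
Proof.
move=> Apos At; have [d d0 AE] := normalization_scale Apos.
have := tight_per_ratio At; set B := corr_normalization A in AE *.
rewrite (per_scale AE) (@per_scale _ (fun i => d i ^+ 2) (fun i => d i ^+ 2)
  (hadamard A (map_mx Num.conj A)) (hadamard B (map_mx Num.conj B))); last first.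
  move=> i j; rewrite !hadamardE ![map_mx _ _ _ _]mxE AE !rmorphM /=.
  by rewrite !(@conj_Creal _ (d _)) ?gtr0_real //; ring.
rewrite !prodrXl; set p := \prod_i d i => h.
have p0 : 0 < p by apply: prodr_gt0.
have -> : rho9t C * (p * p * per B) ^+ 2 = p ^+ 2 * p ^+ 2 * (rho9t C * per B ^+ 2).
  by move: (rho9t C) (per B) => x y; ring.
by rewrite ler_pM2l // mulr_gt0 // exprn_gt0.
Qed.

(** Conjugation exchanges the terms of s and of its inverse. *)
Lemma per_real N (A : 'M[C]_N) : (forall i j, (A i j)^* = A j i) -> per A \is Num.real.
Proof.
move=> Ah; apply/CrealP; rewrite /per rmorph_sum /=.
rewrite (reindex_inj invg_inj) /=; apply: eq_bigr => s _; rewrite rmorph_prod /=.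
rewrite (reindex_inj (@perm_inj _ s)) /=; apply: eq_bigr => i _.
by rewrite permK Ah.
Qed.

Lemma per_hadamard_conj N (A : 'M[C]_N) :
  per (hadamard A (map_mx Num.conj A)) = \sum_(s : 'S_N) `|\prod_i A i (s i)| ^+ 2.
Proof.
apply: eq_bigr => s _; rewrite normr_prod -prodrXl; apply: eq_bigr => i _.
by rewrite hadamardE mxE normCK.
Qed.

(** Cauchy-Schwarz over the permutations, in the form 2 p q x y <= q^2 x^2 + p^2 y^2,
whose weights give equal shares to the two hypotheses. *)
Lemma per_hadamard_le N (A B : 'M[C]_N) (r p q : C) : 0 < p -> 0 < q ->
    per (hadamard A (map_mx Num.conj A)) <= r * p ^+ 2 ->
    per (hadamard B (map_mx Num.conj B)) <= r * q ^+ 2 ->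
  `|per (hadamard A B)| <= r * p * q.
Proof.
rewrite !per_hadamard_conj => p0 q0 hA hB.
have c0 : 0 < p * q *+ 2 by rewrite pmulrn_lgt0 // mulr_gt0.
rewrite -(ler_pM2l c0).
have -> : p * q *+ 2 * (r * p * q) = q ^+ 2 * (r * p ^+ 2) + p ^+ 2 * (r * q ^+ 2).
  by rewrite -mulr_natl; ring.
apply: le_trans (lerD (ler_wpM2l (exprn_ge0 2 (ltW q0)) hA)
  (ler_wpM2l (exprn_ge0 2 (ltW p0)) hB)).
rewrite !mulr_sumr -big_split /=.
apply: le_trans (ler_wpM2l (ltW c0) (ler_norm_sum _ _ _)) _.
rewrite mulr_sumr; apply: ler_sum => s _.
set x := `|\prod_i A i (s i)|; set y := `|\prod_i B i (s i)|.
have -> : `|\prod_i hadamard A B i (s i)| = x * y.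
  rewrite -normrM -big_split; congr `|_|; apply: eq_bigr => i _; exact: hadamardE.
have : 0 <= (q * x - p * y) ^+ 2.
  apply: real_exprn_even_ge0 => //.
  by apply: realB; apply: realM; rewrite /x /y ?normr_real ?gtr0_real.
rewrite sqrrB !exprMn [X in 0 <= X]addrAC subr_ge0.
by rewrite mulrACA (mulrC q p) mulrnAl.
Qed.

End PermanentRatio.

Theorem theorem1p3 (R : realType) :
  [/\ rho9t R[i] < 1,
      forall C : 'M[R[i]]_9, rank4_tight C ->
        per (hadamard C (map_mx Num.conj C)) <= rho9t R[i] * per C ^+ 2,
      forall A : 'M[R[i]]_9,
        psdmx A -> posdiag A -> rank4_tight (corr_normalization A) ->
        per (hadamard A (map_mx Num.conj A)) <= rho9t R[i] * per A ^+ 2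
    & forall A B : 'M[R[i]]_9,
        psdmx A -> posdiag A -> rank4_tight (corr_normalization A) ->
        psdmx B -> posdiag B -> rank4_tight (corr_normalization B) ->
        per (hadamard A B) <= rho9t R[i] * per A * per B].
Proof.
split.
- by rewrite -rho9t_complex -(rmorph1 (real_complex R)) ltcR rho9t_lt1.
- exact: tight_per_ratio.
- by move=> A _; apply: normalization_per_ratio.
move=> A B [Ah _] Ap At [Bh _] Bp Bt.
have pos (M : 'M[R[i]]_9) : posdiag M -> rank4_tight (corr_normalization M) -> 0 < per M.
  move=> Mp Mt; have [d d0 ME] := normalization_scale Mp.
  by rewrite (per_scale ME) mulr_gt0 ?tight_per_gt0 // mulr_gt0 // prodr_gt0.
apply: le_trans (real_ler_norm _) _; last first.
  by apply: per_hadamard_le; rewrite ?pos ?normalization_per_ratio.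
apply: per_real => i j.
by rewrite !hadamardE rmorphM /= (hermsymmx_conj Ah) (hermsymmx_conj Bh).
Qed.
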